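(* Let $\Gamma$ be a countable discrete group and $(X,\mu)$ a standard probability space. The two topologies $\tau_1$ and $\tau_2$ on $\mathrm{A}_\sim(\Gamma,X,\mu)$ coincide: $\tau_1=\tau_2$, where $\tau_1$ is the topology induced by the metric $d$ and $\tau_2$ is the initial topology induced by the map $\Phi:\mathrm{A}_\sim(\Gamma,X,\mu)\to\mathcal K(M_s(K^\Gamma))$.
   Context: A probability space is a standard Borel space with a Borel probability measure (atoms allowed); it is a standard probability space if the measure is nonatomic. A measure-preserving action of $\Gamma$ on $(Y,\nu)$ is a Borel action preserving $\nu$, two actions being identified if they agree almost everywhere; $\gamma^a$ denotes the transformation given by $\gamma\in\Gamma$ under the action $a$. $\mathrm{A}(\Gamma,X,\mu)$ is the set of measure-preserving actions of $\Gamma$ on $(X,\mu)$. Weak containment: for actions $a$ on $(X,\mu)$ and $b$ on $(Y,\nu)$, $a\prec b$ if for all measurable $A_1,\dots,A_n\subseteq X$, finite $F\subseteq\Gamma$ and $\epsilon>0$ there are measurable $B_1,\dots,B_n\subseteq Y$ with $|\mu(\gamma^aA_i\cap A_j)-\nu(\gamma^bB_i\cap B_j)|<\epsilon$ for all $\gamma\in F$, $i,j\le n$. $a\sim b$ means $a\prec b$ and $b\prec a$, and $\mathrm{A}_\sim(\Gamma,X,\mu)=\mathrm{A}(\Gamma,X,\mu)/\!\sim$. Definition of $d$: fix an enumeration $(\gamma_i)_{i\ge1}$ of $\Gamma$ (with repetitions if $\Gamma$ is finite). For $a\in \mathrm{A}(\Gamma,X,\mu)$ and a measurable partition $\mathcal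 A=\{A_1,\dots,A_k\}$ of $X$ into $k$ pieces let $M^{\mathcal A}_{n,k}(a)\in[0,1]^{n\times k\times k}$ have $(p,q,r)$ coordinate $\mu(\gamma_p^aA_q\cap A_r)$, let $C_{n,k}(a)$ be the closure of the set of all $M^{\mathcal A}_{n,k}(a)$ over such $\mathcal A$, and let $d(a,b)=\sum_{n,k=1}^\infty 2^{-(n+k)}d_H(C_{n,k}(a),C_{n,k}(b))$, where $d_H$ is the Hausdorff distance (from the supremum metric on $[0,1]^{n\times k\times k}$). Then $d(a,b)=0$ iff $a\sim b$, so $d$ is a metric on $\mathrm{A}_\sim(\Gamma,X,\mu)$. Definition of $\Phi$: let $K$ be the Cantor set. $\Gamma$ acts on $K^\Gamma$ by the shift $(\gamma^sf)(\delta)=f(\gamma^{-1}\delta)$. $M_s(K^\Gamma)$ is the compact Polish space of shift-invariant Borel probability measures on $K^\Gamma$ (weak* topology) and $\mathcal K(M_s(K^\Gamma))$ is the space of its nonempty compact subsets with the Hausdorff (Vietoris) topology. For $a\in\mathrm{A}(\Gamma,X,\mu)$ and a measurable map $\phi:X\to K$ let $\Phi^{\phi,a}:X\to K^\Gamma$, $\Phi^{\phi,a}(x)(\gamma)=\phi((\gamma^{-1})^ax)$; then $(\Phi^{\phi,a})_*\mu\in M_s(K^\Gamma)$. Let $E(a,K)=\{(\Phi^{\phi,a})_*\mu:\phi:X\to K\text{ measurable}\}$ and $\Phi(a)=\overline{E(a,K)}$. One has $a\sim b$ iff $\Phi(a)=\Phi(b)$, so $\Phi$ descends to $\mathrm{A}_\sim(\Gamma,X,\mu)$.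 *)

(* Defs.v *)
From HB Require Import structures.
From mathcomp Require Import all_boot all_order all_algebra.
From mathcomp Require Import generic_quotient.
From mathcomp Require Import all_classical all_reals all_analysis.

Set Implicit Arguments.
Unset Strict Implicit.
Unset Printing Implicit Defensive.

Import Order.TTheory GRing.Theory Num.Theory.
Import numFieldNormedType.Exports.

Local Open Scope classical_set_scope.
Local Open Scope ring_scope.

Notation borel T := (g_sigma_algebraType (@open T)).

(** ** Standard probability spaces *)

Definition polish (R : realType) (T : completePseudoMetricType R) : Prop :=
  hausdorff_space T /\ exists2 D : set T, countable D & dense D.

(* The measurable space X is Borel isomorphic to a Polish space. *)
Definition standard_borel (R : realType) d (X : measurableType d) : Prop :=
  exists (T : completePseudoMetricType R) (f : X -> T),
    [/\ polish T, bijective f &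
        forall A : set X, measurable A <-> <<s @open T>> (f @` A)].

Definition nonatomic (R : realType) d (X : measurableType d)
    (mu : probability X R) : Prop :=
  forall A, measurable A -> (0 < mu A)%E ->
    exists B, [/\ measurable B, B `<=` A & (0 < mu B < mu A)%E].

(** ** Measure-preserving actions and weak containment *)

Record mp_action (Gamma : groupType) (R : realType) d (X : measurableType d)
    (mu : probability X R) := MpAction {
  act :> Gamma -> X -> X;
  act1 : forall x, act 1%g x = x;
  actM : forall g h x, act (g * h)%g x = act g (act h x);
  measurable_act : forall g, measurable_fun setT (act g);
  mp_act : forall g A, measurable A -> mu (act g @^-1` A) = mu A }.

HB.instance Definition _ Gamma R d (X : measurableType d)
  (mu : probability X R) := gen_eqMixin (mp_action Gamma mu).
HB.instance Definition _ Gamma R d (X : measurableType d)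
  (mu : probability X R) := gen_choiceMixin (mp_action Gamma mu).

Definition weakly_contained (Gamma : groupType) (R : realType)
    d (X : measurableType d) (mu : probability X R)
    d' (Y : measurableType d') (nu : probability Y R)
    (a : mp_action Gamma mu) (b : mp_action Gamma nu) : Prop :=
  forall (n : nat) (A : 'I_n -> set X), (forall i, measurable (A i)) ->
  forall F : set Gamma, finite_set F ->
  forall eps : R, 0 < eps ->
  exists2 B : 'I_n -> set Y, (forall i, measurable (B i)) &
    forall g, F g -> forall i j,
      `| fine (mu (a g @` A i `&` A j)) - fine (nu (b g @` B i `&` B j)) | < eps.

Definition weakly_equivalent (Gamma : groupType) (R : realType)
    d (X : measurableType d) (mu : probability X R)
    d' (Y : measurableType d') (nu : probability Y R)
    (a : mp_action Gamma mu) (b : mp_action Gamma nu) : Prop :=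
  weakly_contained a b /\ weakly_contained b a.

Lemma weakly_contained_refl (Gamma : groupType) (R : realType)
    d (X : measurableType d) (mu : probability X R) (a : mp_action Gamma mu) :
  weakly_contained a a.
Proof. by move=> n A mA F _ eps e0; exists A => // g _ i j; rewrite subrr normr0. Qed.

Lemma weakly_contained_trans (Gamma : groupType) (R : realType)
    d1 (X1 : measurableType d1) (mu1 : probability X1 R)
    d2 (X2 : measurableType d2) (mu2 : probability X2 R)
    d3 (X3 : measurableType d3) (mu3 : probability X3 R)
    (b : mp_action Gamma mu2) (a : mp_action Gamma mu1)
    (c : mp_action Gamma mu3) :
  weakly_contained a b -> weakly_contained b c -> weakly_contained a c.
Proof.
move=> ab bc n A mA F finF eps e0.
have e20 : 0 < eps / 2 by rewrite divr_gt0.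
have [B mB AB] := ab n A mA F finF _ e20.
have [C mC BC] := bc n B mB F finF _ e20.
exists C => // g Fg i j; rewrite (splitr eps).
by rewrite (le_lt_trans (ler_distD (fine (mu2 (b g @` B i `&` B j))) _ _))//
  ltrD ?AB ?BC.
Qed.

Section weak_equivalence_classes.
Context (Gamma : groupType) (R : realType) d (X : measurableType d).
Context (mu : probability X R).

Definition weqb (a b : mp_action Gamma mu) : bool := `[< weakly_equivalent a b >].

Lemma weqb_refl : reflexive weqb.
Proof. by move=> a; apply/asboolP; split; exact: weakly_contained_refl. Qed.

Lemma weqb_sym : symmetric weqb.
Proof. by move=> a b; apply/asboolP/asboolP => -[]. Qed.

Lemma weqb_trans : transitive weqb.
Proof.
move=> b a c /asboolP[ab ba] /asboolP[bc cb]; apply/asboolP.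
by split; apply: (weakly_contained_trans (b := b)).
Qed.

Canonical weq_equiv := EquivRel weqb weqb_refl weqb_sym weqb_trans.

Lemma act_imageE (a : mp_action Gamma mu) g A : a g @` A = a g^-1%g @^-1` A.
Proof.
apply/seteqP; split=> [_ [x Ax <-]|x Ax] /=; first by rewrite -actM mulVg act1.
by exists (a g^-1%g x) => //; rewrite -actM mulgV act1.
Qed.

(* Passing directly to the quotient of actions by weak equivalence is harmless:
   actions that agree almost everywhere are weakly equivalent. *)
Lemma ae_eq_weakly_equivalent (a b : mp_action Gamma mu) :
  (forall g, a g = b g %[ae mu]) -> weakly_equivalent a b.
Proof.
have aux (a' b' : mp_action Gamma mu) :
    (forall g, a' g = b' g %[ae mu]) -> weakly_contained a' b'.
  move=> ab n A mA F _ eps e0; exists A => // g _ i j.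
  suff -> : mu (a' g @` A i `&` A j) = mu (b' g @` A i `&` A j).
    by rewrite subrr normr0.
  have mact (c : mp_action Gamma mu) h k l : measurable (c h @` A k `&` A l).
    apply: measurableI => //; rewrite act_imageE -[X in measurable X]setTI.
    exact: measurable_act.
  have le (c c' : mp_action Gamma mu) : c g^-1%g = c' g^-1%g %[ae mu] ->
      (mu (c g @` A i `&` A j) <= mu (c' g @` A i `&` A j))%E.
    case=> N [mN N0 cN].
    rewrite (le_trans (y := mu ((c' g @` A i `&` A j) `|` N)))//.
      rewrite le_measure ?inE//; first exact: measurableU.
      rewrite !act_imageE => x [cx Ajx].
      have [Nx|nNx] := pselect (N x); [by right|left; split => //].
      have := contra_not (@cN x) nNx => /contrapT /= cc'; move: cx.
      by rewrite /= cc'.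
    by apply: (le_trans (measureU2 _ _ _)) => //; rewrite [X in (_ + X)%E](_ : _ = 0%E) ?adde0.
  by apply/le_anti/andP; split; apply: le; [exact: ab|exact/ae_eq_sym/ab].
by move=> ab; split; [exact: aux|apply: aux => g; exact/ae_eq_sym/ab].
Qed.

End weak_equivalence_classes.

(* A_~(Gamma, X, mu) *)
Definition weq_class (Gamma : groupType) (R : realType) d
    (X : measurableType d) (mu : probability X R) : Type :=
  {eq_quot (@weq_equiv Gamma R d X mu)}%qT.

HB.instance Definition _ Gamma R d (X : measurableType d)
  (mu : probability X R) := Choice.on (@weq_class Gamma R d X mu).
HB.instance Definition _ Gamma R d (X : measurableType d)
  (mu : probability X R) :=
  Quotient.copy (@weq_class Gamma R d X mu) {eq_quot (@weq_equiv Gamma R d X mu)}%qT.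

(** ** The metric d *)

(* An enumeration may have repetitions only if Gamma is finite. *)
Definition enumerates (Gamma : Type) (gam : nat -> Gamma) : Prop :=
  (forall g, exists i, gam i = g) /\
  (infinite_set [set: Gamma] -> injective gam).

(* Intended for nonempty bounded sets. *)
Definition hausdorff_dist (R : realType) (V : normedModType R) (S T : set V) : R :=
  Num.max (sup [set inf [set `|s - t| | t in T] | s in S])
          (sup [set inf [set `|s - t| | s in S] | t in T]).

Section distance.
Context (Gamma : groupType) (gam : nat -> Gamma) (R : realType).
Context d (X : measurableType d) (mu : probability X R).
Implicit Type a : mp_action Gamma mu.

(* Pieces of a partition may be empty. *)
Definition measurable_partition k (A : 'I_k -> set X) : Prop :=
  [/\ forall i, measurable (A i), trivIset setT A & \bigcup_i A i = setT].

(* The space of n x k x k tensors is 'M[R]_(n, k * k), whose norm is the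
   supremum norm: row p lists the entries with first coordinate p. *)
Definition partition_tensor n k a (A : 'I_k -> set X) : 'M[R]_(n, k * k) :=
  \matrix_(p < n) mxvec (\matrix_(q < k, r < k)
    fine (mu (a (gam p) @` A q `&` A r))).

Definition tensor_closure n k a : set 'M[R]_(n, k * k) :=
  closure [set partition_tensor n a A | A in @measurable_partition k].

Definition action_dist (a b : mp_action Gamma mu) : R :=
  fine (\sum_(1 <= n <oo) \sum_(1 <= k <oo)
    (2 ^- (n + k) *
     hausdorff_dist (@tensor_closure n k a) (@tensor_closure n k b))%:E)%E.

(* action_dist depends only on the classes of its arguments, so that the choice
   of representatives is immaterial. *)
Definition weq_dist (x y : weq_class Gamma mu) : R :=
  action_dist (repr x) (repr y).

End distance.

Definition metric_open (R : realType) (T : Type) (dist : T -> T -> R) :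
    set (set T) :=
  [set U | forall x, U x ->
    exists2 eps, 0 < eps & [set y | dist x y < eps] `<=` U].

(** ** Nonempty compact subsets with the Vietoris topology *)

Definition compacts (T : topologicalType) : Type :=
  {C : set T | `[< C !=set0 /\ compact C >]}.

Section vietoris.
Context (T : topologicalType).

HB.instance Definition _ :=
  SubChoice.copy (compacts T) {C : set T | `[< C !=set0 /\ compact C >]}.

(* (true, U) stands for {C | C `<=` U}, (false, U) for {C | C meets U}. *)
Definition vietoris_subbase (i : bool * set T) : set (compacts T) :=
  if i.1 then [set C : compacts T | val C `<=` i.2]
  else [set C : compacts T | val C `&` i.2 !=set0].

HB.instance Definition _ := @isSubBaseTopological.Build (compacts T)
  (bool * set T)%type [set i | open i.2] vietoris_subbase.

End vietoris.

(** ** Shift-invariant measures on K^Gamma, with K the Cantor space *)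

Definition shift_space (Gamma : Type) : Type := {ptws Gamma -> cantor_space}.

HB.instance Definition _ Gamma :=
  Topological.copy (shift_space Gamma) {ptws Gamma -> cantor_space}.
HB.instance Definition _ Gamma :=
  isPointed.Build (shift_space Gamma) (fun=> point).

Definition shift (Gamma : groupType) (g : Gamma) (f : shift_space Gamma) :
  shift_space Gamma := fun h => f (g^-1 * h)%g.

Lemma continuous_shift (Gamma : groupType) (g : Gamma) : continuous (shift g).
Proof.
move=> f; apply/cvg_sup => h; apply: (@continuous_comp_initial (shift_space Gamma)
  (shift_space Gamma) cantor_space (fun f : shift_space Gamma => f h)) => f'.
exact: (@proj_continuous Gamma (fun=> cantor_space) (g^-1 * h)%g f').
Qed.

Lemma measurable_shift (Gamma : groupType) (g : Gamma) :
  measurable_fun setT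
    (shift g : borel (shift_space Gamma) -> borel (shift_space Gamma)).
Proof.
apply: (@measurability _ _ (borel (shift_space Gamma)) (borel (shift_space Gamma))
  _ _ (@open (shift_space Gamma))) => //.
move=> _ [B oB <-]; rewrite setTI; apply: sub_sigma_algebra.
by apply: open_comp oB => ? _; exact: continuous_shift.
Qed.

(* In the library a measure is a function on all sets, with meaningless values
   on non-measurable ones; inv_nonmeas fixes those values, so that every Borel
   measure is represented by exactly one term. *)
Record inv_measure (Gamma : groupType) (R : realType) := InvMeasure {
  inv_prob :> probability (borel (shift_space Gamma)) R;
  inv_shift : forall g (A : set (borel (shift_space Gamma))), measurable A ->
    inv_prob (shift g @^-1` A) = inv_prob A;
  inv_nonmeas : forall A : set (borel (shift_space Gamma)), ~ measurable A ->
    inv_prob A = 0%E }.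

Section inv_measure_topology.
Context (Gamma : groupType) (R : realType).

HB.instance Definition _ := gen_eqMixin (inv_measure Gamma R).
HB.instance Definition _ := gen_choiceMixin (inv_measure Gamma R).

Definition integrals (nu : inv_measure Gamma R) :
    {ptws {f : shift_space Gamma -> R | continuous f} -> R} :=
  fun f => \int[nu]_x sval f x.

(* The weak* topology. *)
HB.instance Definition _ :=
  Topological.copy (inv_measure Gamma R) (initial_topology integrals).

(* The Dirac mass at a constant sequence *)
Definition const_dirac (A : set (borel (shift_space Gamma))) : \bar R :=
  if `[< measurable A >] then \d_(point : borel (shift_space Gamma)) A else 0%E.

Lemma const_diracE A : measurable A ->
  const_dirac A = \d_(point : borel (shift_space Gamma)) A.
Proof. by rewrite /const_dirac => mA; case: asboolP. Qed.

Let const_dirac0 : const_dirac set0 = 0%E.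
Proof. by rewrite const_diracE// measure0. Qed.

Let const_dirac_ge0 A : (0 <= const_dirac A)%E.
Proof. by rewrite /const_dirac; case: ifP. Qed.

Let const_dirac_sigma_additive : semi_sigma_additive const_dirac.
Proof.
move=> F mF tF mUF; rewrite const_diracE//.
rewrite [X in X @ _](_ : _ = fun n =>
    \sum_(0 <= i < n) \d_(point : borel (shift_space Gamma)) (F i))%E.
  exact: measure_semi_sigma_additive.
by apply/funext => n; apply: eq_bigr => i _; rewrite const_diracE.
Qed.

HB.instance Definition _ := isMeasure.Build _ _ _ const_dirac
  const_dirac0 const_dirac_ge0 const_dirac_sigma_additive.

Let const_diracT : const_dirac setT = 1%E.
Proof. by rewrite const_diracE// diracT. Qed.

HB.instance Definition _ :=
  Measure_isProbability.Build _ _ _ const_dirac const_diracT.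

Let const_dirac_shift g (A : set (borel (shift_space Gamma))) :
  measurable A -> const_dirac (shift g @^-1` A) = const_dirac A.
Proof.
move=> mA; rewrite !const_diracE//.
by rewrite -[X in measurable X]setTI; exact: measurable_shift.
Qed.

Let const_dirac_nonmeas (A : set (borel (shift_space Gamma))) :
  ~ measurable A -> const_dirac A = 0%E.
Proof. by rewrite /const_dirac; case: asboolP. Qed.

Definition inv_dirac : inv_measure Gamma R :=
  InvMeasure const_dirac_shift const_dirac_nonmeas.

Lemma compacts_inv_dirac :
  `[< [set inv_dirac] !=set0 /\ compact [set inv_dirac] >].
Proof. by apply/asboolP; split; [exists inv_dirac|exact: compact_set1]. Qed.

End inv_measure_topology.

(** ** The map Phi *)

Section Phi.
Context (Gamma : groupType) (R : realType).
Context d (X : measurableType d) (mu : probability X R).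

Definition orbit_map (phi : X -> cantor_space) (a : mp_action Gamma mu) (x : X) :
  shift_space Gamma := fun g => phi (a g^-1%g x).

(* E(a, K): the condition on nu says that nu is the pushforward of mu by
   orbit_map phi a. *)
Definition orbit_measures (a : mp_action Gamma mu) : set (inv_measure Gamma R) :=
  [set nu | exists2 phi : X -> borel cantor_space, measurable_fun setT phi &
    forall A : set (borel (shift_space Gamma)), measurable A ->
      nu A = mu (orbit_map phi a @^-1` A)].

(* closure (orbit_measures a) is always nonempty and compact, so that the
   default value is never used. *)
Definition action_Phi (a : mp_action Gamma mu) : compacts (inv_measure Gamma R) :=
  insubd (Sub [set inv_dirac Gamma R] (compacts_inv_dirac Gamma R))
    (closure (orbit_measures a)).

(* action_Phi a depends only on the class of a. *)
Definition weq_Phi (x : weq_class Gamma mu) : compacts (inv_measure Gamma R) :=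
  action_Phi (repr x).

End Phi.

(** ** The two topologies, given by their open sets *)

Section topologies.
Context (Gamma : groupType) (gam : nat -> Gamma) (R : realType).
Context d (X : measurableType d) (mu : probability X R).

Definition tau1 : set (set (weq_class Gamma mu)) :=
  metric_open (@weq_dist Gamma gam R d X mu).

Definition tau2 : set (set (weq_class Gamma mu)) :=
  @open (initial_topology (@weq_Phi Gamma R d X mu)).

End topologies.
Arguments tau1 {Gamma} gam {R d X} mu _.
Arguments tau2 Gamma {R d X} mu _.

(* Main.v *)
Require Import Defs.
From HB Require Import structures.
From mathcomp Require Import all_boot all_order all_algebra.
From mathcomp Require Import all_classical all_reals all_analysis.
From mathcomp Require Import measurable_realfun lra.

Set Implicit Arguments.
Unset Strict Implicit.
Unset Printing Implicit Defensive.

Import Order.TTheory GRing.Theory Num.Theory.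
Import numFieldNormedType.Exports.

Local Open Scope classical_set_scope.
Local Open Scope ring_scope.

(** Read a point of K^Gamma through the window made of the first N bits of its
coordinates at gam 0, ..., gam (N - 1).  This code takes finitely many values,
and comparing the laws of the code under two invariant measures in l1 norm gives
a pseudometric [code_dist] which increases with N.  Call two actions a and b
N-near ([orbit_near]) when every measure of E(a, K) is at distance less than
1/(N + 1) from some measure of E(b, K), and conversely.  The theorem holds because
the neighbourhoods of a class in either topology are exactly the sets which
contain all the classes N-near to it, for some N: this is [tau2P] and [tau1P].

For the topology of Phi: a continuous function on the compact space K^Gamma is
uniformly close to a function of the code for a large window, so the balls of
[code_dist] are a neighbourhood base of the weak* topology ([nbhs_inv_measure]).
The space of invariant measures is compact ([compact_inv_measure]): along an
ultrafilter, the values on cylinders converge to a finitely additive function,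
which is countably additive because no cylinder is an infinite disjoint union of
nonempty cylinders, and Caratheodory's theorem extends it.  Hence Phi(a) is the
closure of E(a, K), and near a compact set the Vietoris topology is the topology
of Hausdorff approximation ([nbhs_code_near] and [code_near_nbhs]).

For the topology of d: up to a small tail, d is controlled by finitely many pairs
(n, k), that is by the correlations mu (gam_p A_q /\ A_r) of partitions.  These can
be read off codes: write the label of a point in unary in K, so that the code of x
displays the labels of its translates ([correlations_near_of_codes]).  The
converse, [codes_of_correlations_near], is the heart of the matter, since a code
records the joint law of N translates while d only sees pairs.  The remedy is to
use the code itself as a label.  Under the action a, the row of the code of x at
gam_i is the row at the identity of the code of gam_i^-1 x; thus a pair of codes
violating this rule has correlation 0.  A labelling for b with almost the same
correlations violates the rule on a small set only, and outside that set the label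
of x is the code of the map read from the identity row of the label. *)

(** * Codes and cylinders of the shift space *)

Section codes.
Context (Gamma : groupType) (gam : nat -> Gamma).
Context (gam_surj : forall g, exists i, gam i = g).
Implicit Types (u v : shift_space Gamma) (N M : nat).

Definition word N : Type := {ffun 'I_N * 'I_N -> bool}.

HB.instance Definition _ N := Finite.on (word N).

Definition bit u g (j : nat) : bool := (u g : nat -> bool) j.

(** The same integer bounds the places in the enumeration and the bits, so that
windows form an increasing sequence exhausting all bits of all coordinates. *)
Definition code N u : word N :=
  [ffun p : 'I_N * 'I_N => bit u (gam p.1) p.2].

Definition cylinder N (S : set (word N)) : set (shift_space Gamma) :=
  code N @^-1` S.

Definition word_restr N M (le_NM : (N <= M)%N) (w : word M) : word N :=
  [ffun p : 'I_N * 'I_N => w (widen_ord le_NM p.1, widen_ord le_NM p.2)].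

Lemma word_restr_code N M (le_NM : (N <= M)%N) u :
  word_restr le_NM (code M u) = code N u.
Proof. by apply/ffunP => p; rewrite !ffunE. Qed.

Lemma code_mono N M u v : (N <= M)%N -> code M u = code M v ->
  code N u = code N v.
Proof. by move=> NM uv; rewrite -!(word_restr_code NM) uv. Qed.

Lemma cylinder_mono N M (S : set (word N)) (le_NM : (N <= M)%N) :
  cylinder S = cylinder (word_restr le_NM @^-1` S).
Proof. by apply/seteqP; split => u; rewrite /cylinder /= word_restr_code. Qed.

Lemma continuous_eval g : continuous (fun u => u g).
Proof. by move=> u; exact: (@proj_continuous Gamma (fun=> cantor_space) g u). Qed.

Lemma continuous_bit j : continuous (fun k : cantor_space => (k : nat -> bool) j).
Proof. by move=> k; exact: (@proj_continuous nat (fun=> bool) j k). Qed.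

Lemma nbhs_code_eq N u : nbhs u [set v | code N v = code N u].
Proof.
have -> : [set v | code N v = code N u] = \bigcap_(p : 'I_N * 'I_N)
    [set v : shift_space Gamma | bit v (gam p.1) p.2 =
             bit u (gam p.1) p.2].
  apply/seteqP; split => v /=.
    by move=> /ffunP vu p _; have := vu p; rewrite !ffunE.
  by move=> vu; apply/ffunP => p; rewrite !ffunE; exact: vu.
pose P (p : 'I_N * 'I_N) : set (shift_space Gamma) :=
  [set v : shift_space Gamma | bit v (gam p.1) p.2 = bit u (gam p.1) p.2].
suff Pu p : nbhs u (P p).
  have FF : Filter (nbhs u) := nbhs_filter u.
  apply: (@filterS _ _ FF _ _ _ (filter_forall FF Pu)) => v Pv p _.
  exact: Pv.
have c : {for u, continuous (fun v => bit v (gam p.1) p.2)}.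
  apply: (@continuous_comp _ _ _ (fun v : shift_space Gamma => v (gam p.1))
    (fun k : cantor_space => (k : nat -> bool) p.2)).
    exact: continuous_eval.
  exact: continuous_bit.
exact: (c [set b | b = bit u (gam p.1) p.2]
  (@discrete_set1 bool _)).
Qed.

Lemma open_cylinder N (S : set (word N)) : open (cylinder S).
Proof.
rewrite openE => u Su; apply: filterS (nbhs_code_eq N u) => v /= vu.
by rewrite /cylinder /= vu.
Qed.

Lemma closed_cylinder N (S : set (word N)) : closed (cylinder S).
Proof. by rewrite -[S]setCK; apply: open_closedC; exact: open_cylinder. Qed.

(** Codes separate the finitely many bits on which a basic neighbourhood depends,
because gam is onto.  The proof shows that the filter of the cylinders around u
converges to u, first in each coordinate and then in each bit. *)
Lemma nbhs_cylinder u U : nbhs u U ->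
  exists N, [set v | code N v = code N u] `<=` U.
Proof.
pose F := filter_from setT (fun N => [set v | code N v = code N u]).
have FF : Filter F.
  apply: filter_from_filter; first by exists 0%N.
  move=> M N _ _; exists (maxn M N) => // v /= vu.
  by split; apply: code_mono vu; rewrite ?leq_maxl ?leq_maxr.
suff Fu : F --> u by move=> /Fu[N _ sub]; exists N.
apply/cvg_sup => g; move=> A [_ [[B oB <-] /= Bu] BA]; apply: (@filterS _ F FF _ _ BA).
have : nbhs (u g) B by exact: open_nbhs_nbhs.
pose G : set_system cantor_space := [set C : set cantor_space | F [set v | C (v g)]].
have FG : Filter G.
  split; first by apply: filterS filterT.
  - by move=> P Q; rewrite /G /= => FP FQ; exact: filterI.
  - by move=> P Q PQ; rewrite /G /=; apply: filterS => v; exact: PQ.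
suff Gu : G --> (u g : cantor_space) by move=> /Gu.
apply/cvg_sup => j {A B oB Bu BA} A [_ [[B oB <-] /= Bu] BA].
apply: (@filterS _ G FG _ _ BA).
have [i gi] := gam_surj g.
exists (maxn i j).+1 => // v /= vu.
have im : (i < (maxn i j).+1)%N by rewrite ltnS leq_maxl.
have jm : (j < (maxn i j).+1)%N by rewrite ltnS leq_maxr.
have /ffunP/(_ (Ordinal im, Ordinal jm)) := vu.
by rewrite !ffunE /bit /= gi => ->.
Qed.

Lemma shift_space_compact : compact [set: shift_space Gamma].
Proof.
have := @tychonoff Gamma (fun=> cantor_space) _ (fun=> cantor_space_compact).
by congr (compact _); apply/seteqP; split.
Qed.

Lemma open_bigcup_cylinder U : open U ->
  exists S : forall N, set (word N), U = \bigcup_N cylinder (S N).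
Proof.
move=> oU; exists (fun N => [set w | forall u, code N u = w -> U u]).
apply/seteqP; split => [u Uu|u [N _ /= ]]; last exact.
have [N sub] := nbhs_cylinder (open_nbhs_nbhs (conj oU Uu)).
by exists N => // v /= vu; exact: sub.
Qed.

(** There are countably many windows, so an open set is a countable union of
cylinders. *)
Lemma borel_cylinder :
  <<s @open (shift_space Gamma) >> = <<s [set A | exists N (S : set (word N)), A = cylinder S] >>.
Proof.
apply/seteqP; split; apply: smallest_sub; do ?exact: smallest_sigma_algebra.
  move=> U /open_bigcup_cylinder[S ->].
  apply: sigma_algebra_bigcup => N; apply: sub_sigma_algebra.
  by exists N, (S N).
by move=> _ [N [S ->]]; apply: sub_sigma_algebra; exact: open_cylinder.
Qed.

Lemma measurable_cylinder N (S : set (word N)) :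
  measurable (cylinder S : set (borel (shift_space Gamma))).
Proof. by apply: sub_sigma_algebra; exact: open_cylinder. Qed.

End codes.

(** * Laws of maps into finite sets *)

Section l1_distance.
Context (R : realType) (W : finType).
Implicit Types p q r : W -> R.

Definition l1_dist p q : R := \sum_w `|p w - q w|.

Lemma l1_distxx p : l1_dist p p = 0.
Proof. by rewrite /l1_dist big1// => w _; rewrite subrr normr0. Qed.

Lemma l1_distC p q : l1_dist p q = l1_dist q p.
Proof. by apply: eq_bigr => w _; rewrite distrC. Qed.

Lemma l1_dist_triangle q p r : l1_dist p r <= l1_dist p q + l1_dist q r.
Proof. by rewrite -big_split; apply: ler_sum => w _; exact: ler_distD. Qed.

Lemma l1_dist_sum (S : pred W) p q :
  `|\sum_(w | S w) p w - \sum_(w | S w) q w| <= l1_dist p q.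
Proof.
rewrite -sumrB (le_trans (ler_norm_sum _ _ _))//.
by rewrite /l1_dist [leRHS](bigID S)/= lerDl sumr_ge0.
Qed.

Lemma l1_dist_le e p q : (forall w, `|p w - q w| <= e) ->
  l1_dist p q <= #|W|%:R * e.
Proof.
move=> pq; rewrite mulr_natl -sumr_const.
by apply: ler_sum => w _; exact: pq.
Qed.

End l1_distance.

(** With [law_comp], this makes the distance between codes increase with the
window. *)
Lemma l1_dist_image (R : realType) (W W' : finType) (h : W -> W') (p q : W -> R) :
  l1_dist (fun w' : W' => \sum_(w : W | h w == w') p w)
          (fun w' : W' => \sum_(w : W | h w == w') q w)
  <= l1_dist p q.
Proof.
rewrite [leRHS](partition_big h xpredT)//=; apply: ler_sum => w' _.
by rewrite -sumrB ler_norm_sum.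
Qed.

Section laws.
Context (R : realType) d (T : measurableType d) (P : probability T R).
Context (W : finType).
Implicit Type c : T -> W.

Definition fibers_measurable c := forall w, measurable (c @^-1` [set w]).

Definition law c (w : W) : R := fine (P (c @^-1` [set w])).

Lemma fibers_bigcup c (S : pred W) :
  [set x | S (c x)] = \bigcup_(w in [set w | S w]) (c @^-1` [set w]).
Proof.
apply/seteqP; split => [x Sx|x [w Sw /= xw]]; first by exists (c x).
by rewrite /= xw.
Qed.

Lemma measurable_fibers c (S : pred W) : fibers_measurable c ->
  measurable [set x | S (c x)].
Proof.
by move=> mc; rewrite fibers_bigcup; apply: fin_bigcup_measurable => //; exact: finite_finset.
Qed.

Lemma law_sum c (S : pred W) : fibers_measurable c ->
  fine (P [set x | S (c x)]) = \sum_(w | S w) law c w.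
Proof.
move=> mc; rewrite fibers_bigcup measure_fin_bigcup//; first last.
- by move=> i j _ _ [x [/= <- <-]].
- exact: finite_finset.
rewrite -(@bigfs _ _ _ _ (index_enum W) S) ?index_enum_uniq//; last first.
  by move=> w _; rewrite mem_index_enum.
by rewrite -sum_fine// => w _; rewrite fin_num_measure.
Qed.

Lemma measurable_fibers_ne c c' : fibers_measurable c -> fibers_measurable c' ->
  measurable [set x | c x != c' x].
Proof.
move=> mc mc'; have -> : [set x | c x != c' x] =
    \bigcup_w (c @^-1` [set w] `&` ~` (c' @^-1` [set w])).
  apply/seteqP; split => [x /= /eqP xx|x [v _ [/= <- ?]]].
    by exists (c x) => //; split => //= /esym.
  by rewrite /=; apply/eqP => /esym.
apply: fin_bigcup_measurable => // v _.
by apply: measurableI => //; exact: measurableC.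
Qed.

(** Coupling inequality: an event {c = w} is contained in the union of {c' = w}
and {c <> c'}. *)
Lemma law_ne_le c c' e : fibers_measurable c -> fibers_measurable c' ->
  fine (P [set x | c x != c' x]) <= e -> forall w, `|law c w - law c' w| <= e.
Proof.
move=> mc mc' ne w.
have mne := measurable_fibers_ne mc mc'.
have half (a b : T -> W) : fibers_measurable a -> fibers_measurable b ->
    (forall x, a x != b x -> c x != c' x) -> law a w - law b w <= e.
  move=> ma mb ab; rewrite lerBlDl (le_trans _ (lerD (lexx (law b w)) ne))//.
  rewrite /law -fineD ?fin_num_measure// fine_le ?fin_num_measure//.
    by rewrite fin_numD !fin_num_measure.
  rewrite (le_trans _ (measureU2 _ _ _))// le_measure ?inE//.
    exact: measurableU.
  move=> x /= xw; have [bx|bx] := eqVneq (b x) w; first by left.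
  by right; apply: ab; rewrite xw eq_sym.
by rewrite ler_norml lerNl opprB !half// => x; rewrite eq_sym.
Qed.

End laws.

Lemma law_comp (R : realType) d (T : measurableType d) (P : probability T R)
  (W W' : finType) (c : T -> W) (h : W -> W') : fibers_measurable c ->
  law P (h \o c) = fun w' : W' => \sum_(w : W | h w == w') law P c w.
Proof.
move=> mc; apply/funext => w'; rewrite -law_sum//; congr (fine (P _)).
by apply/seteqP; split => x /= /eqP.
Qed.

(** * Integrals of continuous functions through codes *)

Section weak_star_topology.
Context (Gamma : groupType) (gam : nat -> Gamma) (R : realType).
Context (gam_surj : forall g, exists i, gam i = g).
Implicit Types (nu : inv_measure Gamma R) (N M : nat).

Let bshift := borel (shift_space Gamma).

Lemma code_fibers_measurable N : fibers_measurable (code gam N : bshift -> word N).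
Proof. by move=> w; exact: (@measurable_cylinder _ gam N [set w]). Qed.

Definition code_law N nu : word N -> R := law nu (code gam N : bshift -> word N).

Definition code_dist N nu nu' : R := l1_dist (code_law nu) (code_law (N := N) nu').

Lemma code_dist_mono N M nu nu' : (N <= M)%N ->
  code_dist N nu nu' <= code_dist M nu nu'.
Proof.
move=> NM; rewrite /code_dist /code_law.
have E : (code gam N : bshift -> word N) = word_restr NM \o code gam M.
  by apply/funext => u /=; rewrite word_restr_code.
have mM := @code_fibers_measurable M.
by rewrite E !(law_comp _ _ mM); exact: l1_dist_image.
Qed.

(** Uniform continuity: by compactness of the shift space, one window serves for
all points. *)
Lemma continuous_code (f : shift_space Gamma -> R) (e : R) : continuous f -> 0 < e ->
  exists N, forall u v, code gam N u = code gam N v -> `|f u - f v| < e.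
Proof.
move=> cf e0.
have /compact_near_coveringP ncov := @shift_space_compact Gamma.
have e20 : 0 < e / 2 by rewrite divr_gt0.
have [|N _ HN] := ncov nat \oo (fun N u => forall v,
    code gam N u = code gam N v -> `|f u - f v| < e) _.
  move=> u0 _.
  have /(nbhs_cylinder gam_surj)[N sub] : nbhs u0 [set v | `|f u0 - f v| < e / 2].
    exact: (cf u0 _ (nbhsx_ballx (f u0) (e / 2) e20)).
  exists ([set v | code gam N v = code gam N u0], [set M | (N <= M)%N]).
    split; first exact: nbhs_code_eq.
    by exists N.
  move=> [u M] /= [uu0 NM] v uv.
  have vu0 : code gam N v = code gam N u0.
    by rewrite -uu0; apply: (code_mono NM).
  rewrite (splitr e) (le_lt_trans (ler_distD (f u0) _ _))// ltrD//.
    by rewrite distrC; exact: sub.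
  exact: sub.
by exists N => u v; exact: (HN N (leqnn N)).
Qed.

Lemma continuous_measurable (f : shift_space Gamma -> R) : continuous f ->
  measurable_fun setT (f : bshift -> R).
Proof.
move=> cf; apply: (measurability _ (RGenOInfty.measurableE R)) => _ [_ [x ->] <-].
rewrite setTI; apply: sub_sigma_algebra.
by apply: open_comp => //; exact: interval_open.
Qed.

Lemma continuous_integrable nu (f : shift_space Gamma -> R) : continuous f ->
  nu.-integrable setT (EFin \o (f : bshift -> R)).
Proof.
move=> cf; apply: measurable_bounded_integrable => //.
- by rewrite ltey_eq fin_num_measure.
- exact: continuous_measurable.
have /compact_bounded[M [Mr HM]] : compact (f @` [set: shift_space Gamma]).
  apply: continuous_compact; last exact: shift_space_compact.
  exact: continuous_subspaceT.
by exists M; split => // x Mx u _; apply: (HM x Mx); exists u.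
Qed.

Lemma measurable_code_fun N (g : word N -> R) :
  measurable_fun setT (g \o code gam N : bshift -> R).
Proof.
move=> _ Y mY; rewrite setTI.
exact: (@measurable_cylinder _ gam N (g @^-1` Y)).
Qed.

Lemma code_fun_integrable nu N (g : word N -> R) :
  nu.-integrable setT (EFin \o (g \o code gam N : bshift -> R)).
Proof.
apply: measurable_bounded_integrable => //.
- by rewrite ltey_eq fin_num_measure.
- exact: measurable_code_fun.
exists (\sum_w `|g w|); split; first exact: num_real.
move=> x Mx u _; apply: (le_trans _ (ltW Mx)).
by rewrite (bigD1 (code gam N u))//= lerDl sumr_ge0.
Qed.

Lemma Rintegral_code nu N (g : word N -> R) :
  \int[nu]_u (g (code gam N u)) = \sum_w g w * code_law nu w.
Proof.
pose F w (u : bshift) : \bar R := (g w * \1_(code gam N @^-1` [set w]) u)%:E.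
have Fint w : nu.-integrable setT (F w).
  have -> : F w = EFin \o ((fun w' => g w * (w' == w)%:R) \o code gam N).
    apply/funext => u; rewrite /F /= indicE; congr (g w * (_ : bool)%:R)%:E.
    by apply/idP/eqP => [/set_mem//|uw]; apply/mem_set.
  exact: code_fun_integrable.
have FE w : (\int[nu]_u F w u = (g w * code_law nu w)%:E)%E.
  rewrite /F; under eq_integral do rewrite EFinM.
  rewrite integralZl//=.
    rewrite integral_indic//; last exact: code_fibers_measurable.
    rewrite setIT EFinM /code_law /law fineK// fin_num_measure//.
    exact: code_fibers_measurable.
  by apply: integrable_indic; exact: code_fibers_measurable.
rewrite /Rintegral (eq_integral (fun u => \sum_w F w u)%E); last first.
  move=> u _; rewrite (bigD1 (code gam N u))//= big1 ?adde0.
    by rewrite /F indicE mem_set// mulr1.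
  move=> w wu; rewrite /F indicE memNset ?mulr0//= => uw.
  by rewrite uw eqxx in wu.
rewrite integral_sum//.
by under eq_bigr do rewrite FE; rewrite sumEFin.
Qed.

(** This turns closeness of the laws of a code into closeness of integrals of
continuous functions. *)
Lemma Rintegral_code_approx nu N (f : shift_space Gamma -> R) (g : word N -> R) e :
  continuous f -> (forall u, `|f u - g (code gam N u)| <= e) ->
  `|\int[nu]_u f u - \sum_w g w * code_law nu w| <= e.
Proof.
move=> cf fg; rewrite -Rintegral_code.
have If := continuous_integrable nu cf.
have Ig := code_fun_integrable nu g.
rewrite -RintegralB//.
have Ifg : nu.-integrable setT (EFin \o (fun u : bshift => f u - g (code gam N u))).
  by have := integrableB measurableT If Ig; apply: eq_integrable.
rewrite (le_trans (le_normr_Rintegral _ Ifg))//.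
have E : \int[nu]_(u in [set: bshift]) e = e.
  rewrite Rintegral_cst//; rewrite [X in _ * X](_ : _ = 1) ?mulr1//.
  by rewrite /= [X in fine X]probability_setT.
rewrite -[leRHS]E.
apply: le_Rintegral => //.
- exact: integrable_norm.
- exact: finite_measure_integrable_cst.
Qed.

End weak_star_topology.

(** * Neighbourhoods in the weak* topology *)

Section weak_star_nbhs.
Context (Gamma : groupType) (gam : nat -> Gamma) (R : realType).
Context (gam_surj : forall g, exists i, gam i = g).
Implicit Types (nu : inv_measure Gamma R) (N M : nat).

Lemma continuous_code_fun N (g : word N -> R) :
  continuous (g \o code gam N : shift_space Gamma -> R).
Proof.
move=> u B Bu; apply: (@filterS _ _ (nbhs_filter u) _ _ _ (nbhs_code_eq gam N u)).
by move=> v /= vu; rewrite vu; exact: nbhs_singleton Bu.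
Qed.

Lemma continuous_integral (f : shift_space Gamma -> R) : continuous f ->
  continuous (fun nu => \int[nu]_u f u : R).
Proof.
move=> cf nu; pose f' : {f : shift_space Gamma -> R | continuous f} := exist _ f cf.
apply: (@continuous_comp _ _ _ (@integrals Gamma R)
  (fun h : {ptws {f : shift_space Gamma -> R | continuous f} -> R} => h f')).
  exact: initial_continuous.
move=> B Bh.
have /cvg_sup/(_ f') : nbhs (integrals nu) --> (integrals nu) by exact: cvg_id.
by apply; exact: (@initial_continuous _ _
  (fun h : {ptws {f : shift_space Gamma -> R | continuous f} -> R} => h f')).
Qed.

(** The indicator of a cylinder is continuous, so the law of a code is an integral
of the kind that defines the weak* topology. *)
Lemma continuous_code_law N (w : word N) :
  continuous (fun nu => code_law gam nu w).
Proof.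
have -> : (fun nu => code_law gam nu w) =
    (fun nu => \int[nu]_u ((code gam N u == w)%:R : R)).
  apply/funext => nu; rewrite (Rintegral_code gam nu (fun w' => (w' == w)%:R)).
  rewrite (bigD1 w)//= eqxx mul1r big1 ?addr0// => w' /negPf ->.
  by rewrite mul0r.
exact: (continuous_integral (@continuous_code_fun N (fun w' => (w' == w)%:R))).
Qed.

Lemma cvg_code_dist (F : set_system (inv_measure Gamma R)) nu N (e : R) : Filter F ->
  (forall w : word N, code_law gam nu' w @[nu' --> F] --> code_law gam nu w) ->
  0 < e -> F [set nu' | code_dist gam N nu nu' < e].
Proof.
move=> FF Fnu e0; pose k : R := #|{: word N}|%:R.
have k0 : 0 <= k by [].
have e'0 : 0 < e / (k + 1) by rewrite divr_gt0// ltr_wpDl.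
pose P (w : word N) :=
  [set nu' | `|code_law gam nu w - code_law (N := N) gam nu' w| < e / (k + 1)].
have H : F [set nu' | forall w, P w nu'].
  apply: (@filter_forall _ _ P _ FF) => w.
  exact: (Fnu w _ (nbhsx_ballx _ _ e'0)).
apply: (@filterS _ _ FF _ _ _ H) => nu' /= H'.
apply: (le_lt_trans (l1_dist_le (fun w => ltW (H' w)))).
rewrite -/k mulrA ltr_pdivrMr ?ltr_wpDl//.
by rewrite mulrC ltr_pM2l// ltrDl.
Qed.

Lemma nbhs_code_dist nu N (e : R) : 0 < e ->
  nbhs nu [set nu' | code_dist gam N nu nu' < e].
Proof. by apply: cvg_code_dist => w; exact: continuous_code_law. Qed.

Lemma code_ball_mono N M nu nu' : (N <= M)%N ->
  code_dist gam M nu nu' < M.+1%:R^-1 -> code_dist gam N nu nu' < N.+1%:R^-1.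
Proof.
move=> NM H; apply: le_lt_trans (code_dist_mono _ _ _ NM) (lt_le_trans H _).
by rewrite lef_pV2 ?posrE// ler_nat.
Qed.

(** The radius is tied to the window, so that a single integer indexes a decreasing
neighbourhood base.  An integral of f is known up to e / 3 from the law of a code
on whose fibres f varies by less than e / 3. *)
Lemma nbhs_inv_measure nu U : nbhs nu U ->
  exists N, [set nu' | code_dist gam N nu nu' < N.+1%:R^-1] `<=` U.
Proof.
pose F := filter_from setT (fun N => [set nu' | code_dist gam N nu nu' < N.+1%:R^-1]).
have FF : Filter F.
  apply: filter_from_filter; first by exists 0%N.
  move=> M N _ _; exists (maxn M N) => // nu' /= H.
  by split; apply: code_ball_mono H; rewrite ?leq_maxl ?leq_maxr.
suff Fnu : F --> nu by move=> /Fnu[N _ sub]; exists N.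
move=> A [_ [[V oV <-] /= Vnu] VA]; apply: (@filterS _ F FF _ _ VA).
have : nbhs (integrals nu) V by exact: open_nbhs_nbhs.
pose G : set_system {ptws {f : shift_space Gamma -> R | continuous f} -> R} :=
  [set C | F [set nu' | C (integrals nu')]].
have FG : Filter G.
  split; first by apply: filterS filterT.
  - by move=> P Q; rewrite /G /= => FP FQ; exact: filterI.
  - by move=> P Q PQ; rewrite /G /=; apply: filterS => v; exact: PQ.
suff Gu : G --> integrals nu by move=> /Gu.
apply/cvg_sup => -[f cf] {A V oV Vnu VA} A [_ [[B oB <-] /= Bu] BA].
apply: (@filterS _ G FG _ _ BA).
have /nbhs_ballP[e /= e0 eB] : nbhs (integrals nu (exist _ f cf)) B.
  exact: open_nbhs_nbhs.
have e30 : 0 < e / 3 by rewrite divr_gt0.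
have [N HN] := continuous_code gam_surj cf e30.
(* Not every word need be a code: s w is arbitrary when it is not. *)
pose s w := xget point [set u | code gam N u = w].
pose g w := f (s w).
have fg u : `|f u - g (code gam N u)| <= e / 3.
  apply/ltW/HN; rewrite /s; case: xgetP => [_ _ ->//|/(_ u)]; by case.
pose K := \sum_w `|g w|.
have K0 : 0 <= K by exact: sumr_ge0.
pose M := maxn N (Num.bound (K / (e / 3))).
exists M => // nu' /= H; apply: eB; rewrite /ball /= /integrals /=.
have H1 := Rintegral_code_approx nu cf fg.
have H2 := Rintegral_code_approx nu' cf fg.
have H3 : `|\sum_w g w * code_law gam nu w - \sum_w g w * code_law gam nu' w| < e / 3.
  have le1 : `|\sum_w g w * code_law gam nu w - \sum_w g w * code_law gam nu' w|
      <= K * code_dist gam N nu nu'.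
    rewrite -sumrB (le_trans (ler_norm_sum _ _ _))//.
    rewrite /code_dist /l1_dist mulr_sumr ler_sum// => w _.
    rewrite -mulrBr normrM ler_wpM2r// /K (bigD1 w)//= lerDl.
    exact: sumr_ge0.
  apply: (le_lt_trans le1).
  have le2 : K * code_dist gam N nu nu' <= K * M.+1%:R^-1.
    apply: ler_wpM2l => //; apply: ltW; apply: le_lt_trans H.
    by apply: code_dist_mono; rewrite leq_maxl.
  apply: (le_lt_trans le2).
  rewrite ltr_pdivrMr// mulrC -ltr_pdivrMr//.
  apply: (lt_le_trans (archi_boundP _)); first by rewrite divr_ge0// ltW.
  by rewrite ler_nat (leq_trans (leq_maxr N _))// leqnSn.
move: H1 H2 H3; rewrite !ler_norml !ltr_norml.
set a := Rintegral _ _ _; set b := Rintegral _ _ _.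
move=> /andP[? ?] /andP[? ?] /andP[? ?].
by apply/andP; split; lra.
Qed.

End weak_star_nbhs.

(** * Invariant measures from finitely additive functions on cylinders *)

(** Pushforwards serve twice: for the law of an orbit map, and for moving a measure
from the sigma-algebra generated by cylinders to the Borel sigma-algebra. *)
Section pushforward_inv_measure.
Context (Gamma : groupType) (R : realType).
Context d (T : measurableType d) (m : {measure set T -> \bar R}).
Let bshift := borel (shift_space Gamma).
Context (f : T -> bshift) (mf : measurable_fun setT f).
Context (m1 : m setT = 1%E).
Context (m_shift : forall g (A : set bshift), measurable A ->
  m (f @^-1` (Defs.shift g @^-1` A)) = m (f @^-1` A)).

Let push (A : set bshift) : \bar R := if `[< measurable A >] then m (f @^-1` A) else 0%E.

Let pushE A : measurable A -> push A = m (f @^-1` A).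
Proof. by rewrite /push => mA; case: asboolP. Qed.

Let push0 : push set0 = 0%E.
Proof. by rewrite pushE// preimage_set0 measure0. Qed.

Let push_ge0 A : (0 <= push A)%E.
Proof. by rewrite /push; case: ifP. Qed.

Let push_sigma_additive : semi_sigma_additive push.
Proof.
move=> F mF tF mUF; rewrite pushE// preimage_bigcup.
rewrite [X in X @ _](_ : _ = fun n => \sum_(0 <= i < n) m (f @^-1` F i))%E; last first.
  by apply/funext => n; apply: eq_bigr => i _; rewrite pushE.
apply: measure_semi_sigma_additive.
- by move=> n; rewrite -[X in measurable X]setTI; exact: mf.
- apply/trivIsetP => /= i j _ _ ij; rewrite -preimage_setI.
  by move/trivIsetP : tF => /(_ _ _ _ _ ij) ->//; rewrite preimage_set0.
- by rewrite -preimage_bigcup -[X in measurable X]setTI; exact: mf.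
Qed.

HB.instance Definition _ := isMeasure.Build _ _ _ push push0 push_ge0 push_sigma_additive.

Let push_setT : push setT = 1%E.
Proof. by rewrite pushE// preimage_setT. Qed.

HB.instance Definition _ := Measure_isProbability.Build _ _ _ push push_setT.

Let push_shift g (A : set bshift) : measurable A -> push (Defs.shift g @^-1` A) = push A.
Proof.
move=> mA; have mgA : measurable (Defs.shift g @^-1` A : set bshift).
  by have := @Defs.measurable_shift _ g measurableT _ mA; rewrite setTI.
by rewrite !pushE// m_shift.
Qed.

Let push_nonmeas (A : set bshift) : ~ measurable A -> push A = 0%E.
Proof. by rewrite /push; case: asboolP. Qed.

Lemma pushforward_inv_measure : exists nu : inv_measure Gamma R,
  forall A : set bshift, measurable A -> nu A = m (f @^-1` A).
Proof. by exists (InvMeasure push_shift push_nonmeas) => A mA; exact: pushE. Qed.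

End pushforward_inv_measure.

Section cylinder_algebra.
Context (Gamma : groupType) (gam : nat -> Gamma).

Definition cylinders : set (set (shift_space Gamma)) :=
  [set A | exists N (S : set (word N)), A = cylinder gam S].

Lemma cylinders_code N A : (forall u v, code gam N u = code gam N v -> A u -> A v) ->
  cylinders A.
Proof.
move=> HA; exists N, (code gam N @` A); apply/seteqP; split => [u Au|u [v Av vu]].
  by exists u.
exact: HA Av.
Qed.

Lemma cylinders0 : cylinders set0.
Proof. by exists 0%N, set0; rewrite /cylinder preimage_set0. Qed.

Lemma cylindersC A : cylinders A -> cylinders (~` A).
Proof. by move=> [N [S ->]]; exists N, (~` S). Qed.

Lemma cylindersU A B : cylinders A -> cylinders B -> cylinders (A `|` B).
Proof.
move=> [N [S ->]] [M [S' ->]].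
rewrite (cylinder_mono gam S (leq_maxl N M)) (cylinder_mono gam S' (leq_maxr N M)).
by eexists; exists (word_restr (leq_maxl N M) @^-1` S `|` word_restr (leq_maxr N M) @^-1` S').
Qed.

Lemma cylindersI A B : cylinders A -> cylinders B -> cylinders (A `&` B).
Proof.
by move=> cA cB; rewrite -[A `&` B]setCK setCI; apply/cylindersC/cylindersU; exact: cylindersC.
Qed.

Lemma cylinders_bigsetU (F : nat -> set (shift_space Gamma)) n : (forall i, cylinders (F i)) ->
  cylinders (\big[setU/set0]_(i < n) F i).
Proof.
by move=> cF; elim/big_ind: _ => //; [exact: cylinders0|exact: cylindersU].
Qed.

Lemma open_cylinders A : cylinders A -> open A.
Proof. by move=> [N [S ->]]; exact: open_cylinder. Qed.

(** A copy of the shift space, whose measurable sets are the algebra of cylinders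
and not the Borel sets. *)
Definition cylinder_space : Type := shift_space Gamma.

HB.instance Definition _ := Pointed.on cylinder_space.
HB.instance Definition _ := @isAlgebraOfSets.Build (sigma_display cylinders)
  cylinder_space cylinders cylinders0 cylindersU cylindersC.

Context (gam_surj : forall g, exists i, gam i = g).

(** Each point has a cylinder neighbourhood inside A or inside its complement; by
compactness one window serves for all points. *)
Lemma clopen_cylinders A : open A -> closed A -> cylinders A.
Proof.
move=> oA cA; have /compact_near_coveringP ncov := @shift_space_compact Gamma.
have [|N _ HN] := ncov nat \oo (fun N u => forall v,
    code gam N u = code gam N v -> A u -> A v) _; last first.
  by apply: (@cylinders_code N) => u v; exact: (HN N (leqnn N)).
move=> u0 _.
have [N sub] : exists N, (forall v, code gam N v = code gam N u0 -> A v) \/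
    (forall v, code gam N v = code gam N u0 -> ~ A v).
  have [Au0|nAu0] := pselect (A u0).
    have [N sub] := nbhs_cylinder gam_surj (open_nbhs_nbhs (conj oA Au0)).
    by exists N; left.
  have [N sub] := nbhs_cylinder gam_surj (open_nbhs_nbhs (conj (closed_openC cA) nAu0)).
  by exists N; right.
exists ([set v | code gam N v = code gam N u0], [set M | (N <= M)%N]).
  by split; [exact: nbhs_code_eq|exists N].
move=> [u M] /= [uu0 NM] v uv Au.
have vu0 : code gam N v = code gam N u0 by rewrite -uu0; exact/esym/(code_mono NM).
by case: sub => [|/(_ _ uu0)//]; exact.
Qed.

Lemma closed_cylinders A : cylinders A -> closed A.
Proof. by move=> [N [S ->]]; exact: closed_cylinder. Qed.

Lemma cylinders_shift g A : cylinders A -> cylinders (Defs.shift g @^-1` A).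
Proof.
move=> cA; have cs := @Defs.continuous_shift Gamma g.
apply: clopen_cylinders.
  by apply: open_comp (open_cylinders cA) => ? _; exact: cs.
by apply: closed_comp (closed_cylinders cA) => ? _; exact: cs.
Qed.

(** Cylinders are both open and compact, so a countable union of cylinders which is
a cylinder is a finite union. *)
Lemma cylinders_cover_finite (F : nat -> set (shift_space Gamma)) :
  (forall i, cylinders (F i)) -> cylinders (\bigcup_i F i) ->
  exists n, \bigcup_i F i = \big[setU/set0]_(i < n) F i.
Proof.
move=> cF cUF.
have /compact_near_coveringP ncov : compact (\bigcup_i F i).
  apply: (subclosed_compact _ (@shift_space_compact Gamma)) => //.
  exact: closed_cylinders.
have [|n _ Hn] := ncov nat \oo (fun n u => (\big[setU/set0]_(i < n) F i) u) _.
  move=> u [i _ Fiu]; exists (F i, [set n | (i < n)%N]).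
    split => /=; last by exists i.+1.
    by apply: open_nbhs_nbhs; split => //; exact: open_cylinders.
  by move=> [v n] /= [Fiv ni]; rewrite -bigcup_mkord; exists i.
exists n; apply/seteqP; split; first exact: (Hn n (leqnn n)).
by rewrite -bigcup_mkord => u [i _ ?]; exists i.
Qed.

(** Finite additivity on cylinders suffices for a measure: by
[cylinders_cover_finite] it implies countable additivity on the algebra, and
Caratheodory's extension applies.  Shift invariance passes from cylinders to Borel
sets by uniqueness of the extension. *)
Section extension.
Context (R : realType) (L : set (shift_space Gamma) -> R).
Context (L_ge0 : forall A, 0 <= L A).
Context (L_T : L setT = 1).
Context (L_U : forall A B, cylinders A -> cylinders B -> A `&` B = set0 ->
  L (A `|` B) = L A + L B).
Context (L_shift : forall g A, cylinders A -> L (Defs.shift g @^-1` A) = L A).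

Let Lcyl (A : set cylinder_space) : \bar R := (L A)%:E.

Let L0 : L set0 = 0.
Proof.
have := L_U cylinders0 cylinders0; rewrite setI0 setU0 => /(_ erefl) H; lra.
Qed.

Let Lcyl0 : Lcyl set0 = 0%E.
Proof. by rewrite /Lcyl L0. Qed.

Let Lcyl_ge0 A : (0 <= Lcyl A)%E.
Proof. by rewrite lee_fin. Qed.

Let L_bigsetU (F : nat -> set (shift_space Gamma)) n : (forall i, cylinders (F i)) ->
  trivIset setT F -> L (\big[setU/set0]_(i < n) F i) = \sum_(i < n) L (F i).
Proof.
move=> cF tF; elim: n => [|n IHn]; first by rewrite !big_ord0.
rewrite !big_ord_recr /= L_U ?IHn//; first exact: cylinders_bigsetU.
rewrite -bigcup_mkord setI_bigcupl bigcup0// => i /= ni.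
by move/trivIsetP : tF; apply => //; rewrite ltn_eqF.
Qed.

Let Lcyl_sigma_additive : semi_sigma_additive Lcyl.
Proof.
move=> F mF tF mUF; have [n0 E] := cylinders_cover_finite mF mUF.
apply: cvg_near_cst; exists n0 => // n /= n0n.
rewrite big_mkord /Lcyl sumEFin -L_bigsetU//; congr (L _)%:E.
apply/seteqP; split; first by rewrite -bigcup_mkord => u [i _ ?]; exists i.
rewrite E -!bigcup_mkord => u [i /= ni ?]; exists i => //=.
exact: leq_trans ni n0n.
Qed.

HB.instance Definition _ := isMeasure.Build _ _ _ Lcyl Lcyl0 Lcyl_ge0 Lcyl_sigma_additive.

Let ext := measure_extension Lcyl.

Let bshift := borel (shift_space Gamma).

Let measurable_bshift (A : set bshift) : measurable A -> <<s cylinders >> A.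
Proof. by rewrite /measurable /= (borel_cylinder gam_surj). Qed.

Let measurable_id : measurable_fun setT
  (id : g_sigma_algebraType (@measurable _ cylinder_space) -> bshift).
Proof. by move=> _ A mA; rewrite setTI preimage_id; exact: measurable_bshift. Qed.

Let extE A : cylinders A -> ext A = (L A)%:E.
Proof. by move=> cA; rewrite /ext /measure_extension measurable_mu_extE. Qed.

Lemma cylinder_extension : exists nu : inv_measure Gamma R,
  forall A, cylinders A -> nu A = (L A)%:E.
Proof.
have ext1 : ext setT = 1%E.
  rewrite extE ?L_T//; rewrite -setC0; apply: cylindersC; exact: cylinders0.
have [|nu nuE] := @pushforward_inv_measure Gamma R _ _ ext _ measurable_id ext1 _.
  move=> g A mA; rewrite !preimage_id.
  pose I := g_sigma_algebraType (@measurable _ cylinder_space).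
  have mshift : measurable_fun setT (Defs.shift g : I -> I).
    move=> _ B mB; rewrite setTI; apply: measurable_bshift.
    have mB' : measurable (B : set bshift) by rewrite /measurable /= (borel_cylinder gam_surj).
    by have := @Defs.measurable_shift _ g measurableT _ mB'; rewrite setTI.
  pose ext' := measure_function_pushforward__canonical__measure_function_Measure ext mshift.
  suff : ext A = ext' A by [].
  apply: (@g_sigma_algebra_measure_unique _ R I cylinders _ (fun=> setT)).
  - exact: sub_sigma_algebra.
  - by move=> _; rewrite -setC0; apply: cylindersC; exact: cylinders0.
  - by apply/seteqP; split => // u _; exists 0%N.
  - exact: cylindersI.
  - move=> B cB; have cgB := cylinders_shift g cB.
    suff : ext B = ext (Defs.shift g @^-1` B) by [].
    by rewrite (extE cB) (extE cgB) L_shift.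
  - by move=> _; rewrite [X in (X < _)%E]ext1 ltry.
  - exact: measurable_bshift.
exists nu => A cA; have mA : measurable (A : set bshift).
  by apply: sub_sigma_algebra; exact: open_cylinders.
by rewrite (nuE _ mA); exact: extE.
Qed.

End extension.

End cylinder_algebra.

(** * Compactness of the space of invariant measures *)

Section inv_measure_compact.
Context (Gamma : groupType) (gam : nat -> Gamma) (R : realType).
Context (gam_surj : forall g, exists i, gam i = g).
Let bshift := borel (shift_space Gamma).

Lemma ultra_cvg_bounded (T : Type) (F : set_system T) (h : T -> R) :
  UltraFilter F -> (forall t, 0 <= h t <= 1) -> exists l : R, h @ F --> l.
Proof.
move=> FU h01; have FF : ProperFilter F := ultra_proper.
have F01 : (h @ F) `[0, 1]%classic.
  by apply: (@filterS _ F _ setT _ _ filterT) => t _; rewrite /= in_itv/=.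
have [l [_ Fl]] := @segment_compact R 0 1 (h @ F) _ F01.
exists l => B Bl; have [//|FnB] := in_ultra_setVsetC (h @^-1` B) FU.
have [y [/= nBy By]] := Fl (~` B) B FnB Bl.
by case: nBy.
Qed.

(** The ultralimit L of the values of the measures is finitely additive and shift
invariant; the measure extending L has its laws of codes equal to the ultralimits
of the laws of codes, so it is a weak* limit. *)
Lemma compact_inv_measure : compact [set: inv_measure Gamma R].
Proof.
rewrite compact_ultra => F FU _; have FF : ProperFilter F := ultra_proper.
have fin01 (A : set bshift) (nu : inv_measure Gamma R) : 0 <= fine (nu A) <= 1.
  rewrite fine_ge0//=; have [mA|nmA] := pselect (measurable A).
    rewrite -lee_fin fineK ?fin_num_measure//; exact: probability_le1.
  by rewrite inv_nonmeas.
have /choice[L FL] : forall A : set (shift_space Gamma), exists l : R,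
    fine ((nu : inv_measure Gamma R) (A : set bshift)) @[nu --> F] --> l.
  by move=> A; exact: ultra_cvg_bounded.
have LE A l : fine ((nu : inv_measure Gamma R) (A : set bshift)) @[nu --> F] --> l ->
    L A = l.
  by move=> Al; exact: (cvg_unique (@norm_hausdorff _ R) (FL A) Al).
have mcyl A : cylinders gam A -> measurable (A : set bshift).
  by move=> cA; apply: sub_sigma_algebra; exact: open_cylinders cA.
have [||||nu nuL] := @cylinder_extension Gamma gam gam_surj R L.
- move=> A; apply: (closed_cvg (fun y : R => 0 <= y) (@closed_ge R 0) _ _ (FL A)).
  by apply: nearW => nu /=; have /andP[] := fin01 A nu.
- apply: LE; under eq_fun do rewrite probability_setT; exact: cvg_cst.
- move=> A B cA cB AB; apply: LE.
  have mA := mcyl _ cA; have mB := mcyl _ cB.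
  have -> : (fun nu : inv_measure Gamma R => fine (nu (A `|` B))) =
      (fun nu => fine (nu A) + fine (nu B)).
    by apply/funext => nu; rewrite measureU// fineD ?fin_num_measure.
  by apply: cvgD; exact: FL.
- move=> g A cA; apply: LE.
  have mA := mcyl _ cA.
  have -> : (fun nu : inv_measure Gamma R => fine (nu (Defs.shift g @^-1` A))) =
      (fun nu => fine (nu A)) by apply/funext => nu; rewrite inv_shift.
  exact: FL.
exists nu; split => // U /(nbhs_inv_measure gam_surj)[N sub].
apply: (@filterS _ F _ _ _ sub); apply: cvg_code_dist => // w.
have cw : cylinders gam (code gam N @^-1` [set w]) by exists N, [set w].
rewrite {2}/code_law /law nuL//=.
exact: FL.
Qed.

End inv_measure_compact.

(** * Orbit maps and their laws *)

Section orbit_laws.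
Context (Gamma : groupType) (gam : nat -> Gamma) (R : realType).
Context (gam_surj : forall g, exists i, gam i = g).
Context d (X : measurableType d) (mu : probability X R).
Let bshift := borel (shift_space Gamma).
Implicit Types (a : mp_action Gamma mu) (phi : X -> cantor_space).

Definition measurable_label phi : Prop :=
  measurable_fun setT (phi : X -> borel cantor_space).

Lemma measurable_bit phi a g j b : measurable_label phi ->
  measurable [set x | (phi (a g x) : nat -> bool) j = b].
Proof.
move=> mphi; have mB : measurable
    ([set k | (k : nat -> bool) j = b] : set (borel cantor_space)).
  apply: sub_sigma_algebra.
  have := @open_comp _ _ (fun k : cantor_space => (k : nat -> bool) j) [set b].
  apply; first by move=> ? _; exact: continuous_bit.
  exact: discrete_open.
have m1 := mphi measurableT _ mB; rewrite setTI in m1.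
by have := measurable_act a g measurableT m1; rewrite setTI.
Qed.

Definition orbit_code N phi a x : word N := code gam N (orbit_map phi a x).

Lemma orbit_code_measurable N phi a : measurable_label phi ->
  fibers_measurable (orbit_code N phi a).
Proof.
move=> mphi w.
have -> : orbit_code N phi a @^-1` [set w] = \bigcap_(p : 'I_N * 'I_N)
    [set x | (phi (a (gam p.1)^-1%g x) : nat -> bool) p.2 = w p].
  apply/seteqP; split => [x /= <- p _|x xw] /=; first by rewrite ffunE.
  by apply/ffunP => p; rewrite ffunE; exact: xw.
by apply: fin_bigcap_measurable => // p _; exact: measurable_bit.
Qed.

Lemma measurable_orbit_map phi a : measurable_label phi ->
  measurable_fun setT (orbit_map phi a : X -> bshift).
Proof.
move=> mphi; apply: (@measurability _ _ _ bshift setT _ (cylinders gam)).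
  by rewrite /measurable /= (borel_cylinder gam_surj).
move=> _ [_ [N [S ->]] <-]; rewrite setTI.
have -> : orbit_map phi a @^-1` cylinder gam S =
    [set x | `[< S (orbit_code N phi a x) >]].
  by apply/seteqP; split => x /= => [Sx|/asboolP//]; exact/asboolP.
exact: (measurable_fibers (fun w => `[< S w >]) (orbit_code_measurable a mphi)).
Qed.

Lemma orbit_measure_ex phi a : measurable_label phi ->
  exists nu : inv_measure Gamma R, forall A : set bshift, measurable A ->
    nu A = mu (orbit_map phi a @^-1` A).
Proof.
move=> mphi; have mo := measurable_orbit_map a mphi.
apply: (pushforward_inv_measure mo); first exact: probability_setT.
move=> g A mA.
have -> : orbit_map phi a @^-1` (Defs.shift g @^-1` A) =
    a g @^-1` (orbit_map phi a @^-1` A).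
  apply/seteqP; split => x /=; congr A; apply/funext => h;
    by rewrite /Defs.shift /orbit_map -actM invgM invgK.
by apply: mp_act; have := mo measurableT _ mA; rewrite setTI.
Qed.

Lemma orbit_measures_neq0 a : orbit_measures a !=set0.
Proof.
have mphi : measurable_label (fun _ : X => point : cantor_space) by exact: measurable_cst.
have [nu nuE] := orbit_measure_ex a mphi.
by exists nu, (fun=> point).
Qed.

(** The default value in the definition of Phi is ruled out by compactness. *)
Lemma action_PhiE a : val (action_Phi a) = closure (orbit_measures a).
Proof.
rewrite /action_Phi insubdK//; apply/asboolP; split.
  by have [nu Enu] := orbit_measures_neq0 a; exists nu; exact: subset_closure.
have C := @compact_inv_measure _ _ R gam_surj.
apply: (@subclosed_compact (inv_measure Gamma R) _ setT) => //.
exact: closed_closure.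
Qed.

Lemma orbit_code_law N phi a (nu : inv_measure Gamma R) :
  (forall A : set bshift, measurable A -> nu A = mu (orbit_map phi a @^-1` A)) ->
  code_law gam nu = law mu (orbit_code N phi a).
Proof.
move=> nuE; apply/funext => w; rewrite /code_law /law nuE//.
exact: code_fibers_measurable.
Qed.

End orbit_laws.

(** * Neighbourhoods in the Vietoris topology *)

Section vietoris_topology.
Context (T : topologicalType).

Lemma open_vietoris_subbase b (U : set T) : open U ->
  open (vietoris_subbase (b, U)).
Proof.
move=> oU; exists [set vietoris_subbase (b, U)]; last by rewrite bigcup_set1.
by move=> _ ->; exact: finI_from1.
Qed.

(** A filter converges as soon as it contains the subbasic neighbourhoods of the
limit, since it is closed under finite intersections. *)
Lemma vietoris_filter (F : set_system (compacts T)) (C : compacts T) : Filter F ->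
  (forall b (U : set T), open U -> vietoris_subbase (b, U) C ->
    F (vietoris_subbase (b, U))) ->
  F --> C.
Proof.
move=> FF FC A; rewrite nbhsE => -[V [[D Dsub <-] [B DB BC]] VA].
apply: (@filterS _ F FF B); first by move=> C' BC'; apply: VA; exists B.
have [I ID IB] := Dsub _ DB.
move: BC; rewrite -IB => BC; apply: filter_bigI => -[b U] /[dup] bUI /ID; rewrite inE /= => oU.
by apply: FC => //; exact: (BC (b, U) bUI).
Qed.

End vietoris_topology.

Section code_near.
Context (Gamma : groupType) (gam : nat -> Gamma) (R : realType).
Context (gam_surj : forall g, exists i, gam i = g).
Local Notation dist N := (@code_dist Gamma gam R N).
Implicit Types (S : set (inv_measure Gamma R)) (C : compacts (inv_measure Gamma R)).

Definition code_near N (e : R) S (S1 : set (inv_measure Gamma R)) : Prop :=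
  (forall nu', S1 nu' -> exists2 nu, S nu & dist N nu nu' < e) /\
  (forall nu, S nu -> exists2 nu', S1 nu' & dist N nu nu' < e).

Lemma code_dist_triangle N nu1 nu nu2 : dist N nu nu2 <= dist N nu nu1 + dist N nu1 nu2.
Proof. exact: l1_dist_triangle. Qed.
Arguments code_dist_triangle {N} nu1 nu nu2.

Lemma code_distC N nu nu' : dist N nu nu' = dist N nu' nu.
Proof. exact: l1_distC. Qed.
Arguments code_distC {N} nu nu'.

Lemma code_near_mono N M e e' S S1 : (N <= M)%N -> e <= e' ->
  code_near M e S S1 -> code_near N e' S S1.
Proof.
move=> NM ee' [h1 h2]; split.
- move=> nu' /h1[nu Snu h]; exists nu => //.
  exact: le_lt_trans (code_dist_mono _ _ _ NM) (lt_le_trans h ee').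
- move=> nu /h2[nu' Snu h]; exists nu' => //.
  exact: le_lt_trans (code_dist_mono _ _ _ NM) (lt_le_trans h ee').
Qed.

Lemma code_closure N e S nu : 0 < e -> closure S nu ->
  exists2 nu', S nu' & dist N nu nu' < e.
Proof. by move=> e0 /(_ _ (nbhs_code_dist gam nu N e0))[nu' [Snu' h]]; exists nu'. Qed.

Lemma code_near_closure N e S S1 : 0 < e -> code_near N e S S1 ->
  code_near N (2 * e) (closure S) (closure S1).
Proof.
move=> e0 [h1 h2]; split.
- move=> nu' /(code_closure N e0)[nu1 /h1[nu Snu h] h'].
  exists nu; first exact: subset_closure.
  by rewrite (le_lt_trans (code_dist_triangle nu1 _ _))// (code_distC nu1 nu'); lra.
- move=> nu /(code_closure N e0)[nu1 /h2[nu' Snu h] h'].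
  exists nu'; first exact: subset_closure.
  by rewrite (le_lt_trans (code_dist_triangle nu1 _ _))//; lra.
Qed.

Lemma closure_code_near N e S S1 : 0 < e -> code_near N e (closure S) (closure S1) ->
  code_near N (2 * e) S S1.
Proof.
move=> e0 [h1 h2]; split.
- move=> nu' /subset_closure/h1[nu1 /(code_closure N e0)[nu Snu h] h'].
  exists nu => //.
  by rewrite (le_lt_trans (code_dist_triangle nu1 _ _))// (code_distC nu); lra.
- move=> nu /subset_closure/h2[nu1 /(code_closure N e0)[nu' Snu h] h'].
  exists nu' => //.
  by rewrite (le_lt_trans (code_dist_triangle nu1 _ _))//; lra.
Qed.

Lemma open_code_ball N nu e : open [set nu' | dist N nu nu' < e].
Proof.
rewrite openE => nu' /= h; have e'0 : 0 < e - dist N nu nu' by rewrite subr_gt0.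
have FF : Filter (nbhs nu') := nbhs_filter nu'.
apply: (@filterS _ _ FF _ _ _ (nbhs_code_dist gam nu' N e'0)) => nu2 /= h2.
by rewrite (le_lt_trans (code_dist_triangle nu' _ _))//; lra.
Qed.

(** The first half of [code_near] holds on a subbasic open set of the first kind.  The
second half would need finitely many subbasic sets of the second kind, one for each
ball of a finite cover of C; covering C along the filter of neighbourhoods of C
avoids naming them. *)
Lemma nbhs_code_near C N e : 0 < e ->
  nbhs C [set C' : compacts (inv_measure Gamma R) | code_near N e (val C) (val C')].
Proof.
move=> e0; have e20 : 0 < e / 2 by rewrite divr_gt0.
have /asboolP[_ cC] := valP C.
have FF : Filter (nbhs C) := nbhs_filter C.
pose ball (nu : inv_measure Gamma R) (e : R) := [set nu' | dist N nu nu' < e].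
have dist0 nu : dist N nu nu = 0 by exact: l1_distxx.
apply: (@filterI _ _ FF).
  have oU : open (\bigcup_(nu in val C) ball nu e).
    by apply: bigcup_open => nu _; exact: open_code_ball.
  have CU : vietoris_subbase (true, \bigcup_(nu in val C) ball nu e) C.
    by move=> nu Cnu; exists nu => //; rewrite /ball /= dist0.
  have := open_nbhs_nbhs (conj (open_vietoris_subbase true oU) CU).
  apply: (@filterS _ _ FF) => C' C'U nu' /C'U[nu Cnu h].
  by exists nu.
have /compact_near_coveringP ncov := cC.
apply: (ncov _ (nbhs C) (fun C' nu => exists2 nu', val C' nu' & dist N nu nu' < e) FF).
move=> nu0 Cnu0.
exists (ball nu0 (e / 2), vietoris_subbase (false, ball nu0 (e / 2))) => [|[nu C']].
  split; first exact: nbhs_code_dist.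
  apply: open_nbhs_nbhs; split; first exact: open_vietoris_subbase (open_code_ball _ _ _).
  by exists nu0; split => //; rewrite /ball /= dist0.
move=> /= [h1 [nu' [C'nu' h2]]]; exists nu' => //; rewrite /ball /= in h1 h2.
by rewrite (le_lt_trans (code_dist_triangle nu0 _ _))// (code_distC nu); lra.
Qed.

(** For the sets contained in U this is a Lebesgue number argument: by compactness
of C, one window and one radius work for all points of C. *)
Lemma code_near_nbhs C (O : set (compacts (inv_measure Gamma R))) : nbhs C O ->
  exists N, forall C', code_near N N.+1%:R^-1 (val C) (val C') -> O C'.
Proof.
pose F := filter_from setT (fun N =>
  [set C' : compacts (inv_measure Gamma R) | code_near N N.+1%:R^-1 (val C) (val C')]).
have FF : Filter F.
  apply: filter_from_filter; first by exists 0%N.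
  move=> M N _ _; exists (maxn M N) => // C' /= H.
  by split; apply: code_near_mono H; rewrite ?leq_maxl ?leq_maxr// lef_pV2 ?posrE//
    ler_nat ltnS ?leq_maxl ?leq_maxr.
suff FC : F --> C by move=> /FC[N _ sub]; exists N.
apply: vietoris_filter => -[] U oU /= CU.
- have /asboolP[_ /compact_near_coveringP ncov] := valP C.
  have [|N _ HN] := ncov nat \oo (fun N nu => [set nu' | dist N nu nu' < N.+1%:R^-1] `<=` U) _.
    move=> nu0 /CU Unu0.
    have [N0 sub] := nbhs_inv_measure gam_surj (open_nbhs_nbhs (conj oU Unu0)).
    (* 1 / (2 N0 + 2) is half of the radius 1 / (N0 + 1) *)
    have d0 : 0 < N0.*2.+2%:R^-1 :> R by rewrite invr_gt0.
    exists ([set nu | dist N0 nu0 nu < N0.*2.+2%:R^-1], [set N | (N0.*2.+1 <= N)%N]).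
      by split; [exact: nbhs_code_dist|exists N0.*2.+1].
    move=> [nu N] /= [h1 NN] nu' /= h2; apply: sub => /=.
    have h3 : dist N0 nu nu' < N0.*2.+2%:R^-1.
      apply: le_lt_trans (code_dist_mono _ _ _ (_ : (N0 <= N)%N)) (lt_le_trans h2 _).
        by apply: leq_trans NN; rewrite -addnn -addnS leq_addr.
      by rewrite lef_pV2 ?posrE// ler_nat.
    have -> : N0.+1%:R^-1 = N0.*2.+2%:R^-1 + N0.*2.+2%:R^-1 :> R.
      by rewrite [LHS]splitr -!invfM -!natrM muln2 doubleS.
    by rewrite (le_lt_trans (code_dist_triangle nu _ _))// ltrD.
  exists N => // C' [h1 _] nu' /h1[nu Cnu h].
  exact: (HN N (leqnn N) nu Cnu).
- case: CU => nu [Cnu Unu].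
  have [N sub] := nbhs_inv_measure gam_surj (open_nbhs_nbhs (conj oU Unu)).
  exists N => // C' [_ /(_ nu Cnu)[nu' C'nu' h]].
  by exists nu'; split => //; exact: sub.
Qed.

End code_near.

(** * Neighbourhoods in the initial topology of Phi *)

Section initial_topology_Phi.
Context (Gamma : groupType) (gam : nat -> Gamma) (R : realType).
Context (gam_surj : forall g, exists i, gam i = g).
Context d (X : measurableType d) (mu : probability X R).

Definition orbit_near N (a b : mp_action Gamma mu) : Prop :=
  code_near gam N N.+1%:R^-1 (orbit_measures a) (orbit_measures b).

Lemma orbit_near_mono N M a b : (N <= M)%N -> orbit_near M a b -> orbit_near N a b.
Proof. by move=> NM; apply: code_near_mono => //; rewrite lef_pV2 ?posrE// ler_nat. Qed.

(** Passing between E(a, K) and its closure Phi(a) costs a factor 2, which is paid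
by replacing N with 2 N + 1. *)
Lemma tau2P (V : set (weq_class Gamma mu)) : tau2 Gamma mu V <->
  forall x, V x -> exists N, forall y, orbit_near N (repr x) (repr y) -> V y.
Proof.
have half N : 2 * N.*2.+2%:R^-1 = N.+1%:R^-1 :> R.
  by rewrite -doubleS -muln2 natrM invfM mulrCA mulfV ?mulr1.
split=> [[W oW <-] x /= Wx|HV].
  have [N HN] := code_near_nbhs gam_surj (open_nbhs_nbhs (conj oW Wx)).
  exists N.*2.+1 => y xy; apply: HN.
  rewrite !(action_PhiE gam_surj) -half.
  apply: (@code_near_mono _ gam _ N N.*2.+1 _ _ _ _ _ (lexx _)).
    by rewrite -addnn -addnS leq_addr.
  by apply: code_near_closure xy; rewrite invr_gt0.
rewrite /tau2 openE => x /HV[N HN].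
have e0 : 0 < N.*2.+2%:R^-1 :> R by rewrite invr_gt0.
have := initial_continuous (nbhs_code_near gam (weq_Phi x) N e0).
apply: (@filterS _ _ (nbhs_filter (x : initial_topology (@weq_Phi Gamma R d X mu)))).
move=> y /= xy; apply: HN; rewrite /orbit_near -half.
by apply: closure_code_near => //; move: xy; rewrite /weq_Phi !(action_PhiE gam_surj).
Qed.

End initial_topology_Phi.

(** * Weighted series and Hausdorff distance *)

Section weighted_series.
Context (R : realType).
Local Open Scope ereal_scope.

Lemma sum_geometric_le (K : nat) :
  (\sum_(1 <= k < K) (3 / 4) ^+ k <= 4 :> R)%R.
Proof.
case: K => [|K]; first by rewrite big_geq.
suff : (\sum_(1 <= k < K.+1) (3 / 4) ^+ k + 4 * (3 / 4) ^+ K.+1 <= 4 :> R)%R.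
  by apply: le_trans; rewrite lerDl mulr_ge0// exprn_ge0// divr_ge0.
elim: K => [|K IHK]; first by rewrite big_geq//= expr1; lra.
rewrite big_nat_recr//= (exprS _ K.+1).
by move: IHK; set s := bigop _ _ _; set q := (_ ^+ K.+1)%R => ?; lra.
Qed.

Lemma nneseries_geometric_le (u : nat -> \bar R) (c : R) : (0 <= c)%R ->
  (forall k, 0 <= u k) -> (forall k, (1 <= k)%N -> u k <= (c * (3 / 4) ^+ k)%:E) ->
  \sum_(1 <= k <oo) u k <= (4 * c)%:E.
Proof.
move=> c0 u0 uc; apply: lime_le; first by apply: is_cvg_nneseries => *; exact: u0.
apply: nearW => K; rewrite (@le_trans _ _ (\sum_(1 <= k < K) (c * (3 / 4) ^+ k)%:E))//.
  by rewrite !big_nat; apply: lee_sum => k /andP[k1 _]; exact: uc.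
rewrite sumEFin lee_fin -mulr_sumr mulrC ler_wpM2r//.
exact: sum_geometric_le.
Qed.

Lemma le_nneseries_term (u : nat -> \bar R) k : (1 <= k)%N -> (forall k, 0 <= u k) ->
  u k <= \sum_(1 <= k <oo) u k.
Proof.
move=> k1 u0; apply: le_trans (nneseries_lim_ge k.+1 _); last by move=> *; exact: u0.
by rewrite big_nat_recr//= leeDr// sume_ge0.
Qed.

Context (u : nat -> nat -> R).
Context (u_ge0 : forall n k, (0 <= u n k)%R).

Let U n k := (2 ^- (n + k) * u n k)%:E.

Let U_ge0 n k : 0 <= U n k.
Proof. by rewrite lee_fin mulr_ge0// invr_ge0 exprn_ge0. Qed.

(** The weight 2^-(n + k) is (2 / 3)^(n + k) times the summable weight
(3 / 4)^(n + k): the first factor makes the tail n + k > M small, and summing the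
second one over both indices gives at most 16. *)
Lemma weighted_series_le (M : nat) (e : R) :
  (forall n k, (1 <= n)%N -> (1 <= k)%N -> (u n k <= 1)%R) ->
  (forall n k, (1 <= n)%N -> (1 <= k)%N -> (n + k <= M)%N -> (u n k <= e)%R) ->
  ((2 / 3) ^+ M <= e)%R ->
  \sum_(1 <= n <oo) \sum_(1 <= k <oo) U n k <= (16 * e)%:E.
Proof.
move=> u1 ue Me.
have e0 : (0 <= e)%R by apply: le_trans Me; rewrite exprn_ge0.
have -> : (16 * e = 4 * (4 * e))%R by lra.
apply: nneseries_geometric_le; first by lra.
  by move=> n; apply: nneseries_ge0 => *; exact: U_ge0.
move=> n n1; rewrite -mulrA; apply: nneseries_geometric_le.
- by rewrite mulr_ge0// exprn_ge0.
- exact: U_ge0.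
move=> k k1; rewrite lee_fin -mulrA -exprD mulrC.
set j := (n + k)%N.
have q0 : (0 <= (3 / 4) ^+ j :> R)%R by rewrite exprn_ge0.
have [jM|Mj] := leqP j M.
  apply: ler_pM; rewrite ?ue// ?invr_ge0 ?exprn_ge0//.
  by rewrite -exprVn lerXn2r ?nnegrE//; lra.
apply: (@le_trans _ _ (1 * 2 ^- j)%R).
  by rewrite ler_wpM2r ?u1// invr_ge0 exprn_ge0.
have -> : (2 ^- j = (2 / 3) ^+ j * (3 / 4) ^+ j :> R)%R.
  by rewrite -exprMn -exprVn; congr (_ ^+ _)%R; lra.
rewrite mul1r ler_wpM2r// (le_trans _ Me)//.
apply: ler_wiXn2l; [lra|lra|exact: ltnW].
Qed.

Lemma weighted_series_term n k : (1 <= n)%N -> (1 <= k)%N ->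
  U n k <= \sum_(1 <= n <oo) \sum_(1 <= k <oo) U n k.
Proof.
move=> n1 k1; apply: (le_trans (le_nneseries_term k1 (U_ge0 n))).
apply: (@le_nneseries_term (fun n => \sum_(1 <= k <oo) U n k) _ n1) => m.
by apply: nneseries_ge0 => *; exact: U_ge0.
Qed.

End weighted_series.

Section hausdorff_distance.
Context (R : realType) (V : normedModType R).
Implicit Types S T : set V.

Lemma hausdorff_distC S T : hausdorff_dist S T = hausdorff_dist T S.
Proof.
rewrite /hausdorff_dist maxC; congr Num.max.
  by congr sup; apply: eq_imagel => t _; congr inf; apply: eq_imagel => s _; rewrite distrC.
by congr sup; apply: eq_imagel => t _; congr inf; apply: eq_imagel => s _; rewrite distrC.
Qed.

Let dist_set_lb (s : V) T : has_lbound [set `|s - t| | t in T].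
Proof. by exists 0 => _ [t _ <-]. Qed.

Let sup_inf_closure_le (e : R) S T : S !=set0 ->
  (forall s, S s -> exists2 t, T t & `|s - t| <= e) ->
  sup [set inf [set `|s - t| | t in closure T] | s in closure S] <= e.
Proof.
move=> [s0 Ss0] ST; apply: ge_sup.
  by exists (inf [set `|s0 - t| | t in closure T]), s0 => //; exact: subset_closure.
move=> _ [s cSs <-]; apply/ler_addgt0Pr => r r0.
have [s1 [Ss1 s1s]] := cSs _ (nbhsx_ballx s r r0).
have [t Tt st] := ST _ Ss1.
apply: (@le_trans _ _ `|s - t|).
  by apply: (ge_inf (dist_set_lb _ _)); exists t => //; exact: subset_closure.
rewrite (le_trans (ler_distD s1 _ _))// addrC lerD// ltW//.
by move: s1s; rewrite -ball_normE.
Qed.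

Lemma hausdorff_dist_closure_le (e : R) S T : S !=set0 -> T !=set0 ->
  (forall s, S s -> exists2 t, T t & `|s - t| <= e) ->
  (forall t, T t -> exists2 s, S s & `|t - s| <= e) ->
  hausdorff_dist (closure S) (closure T) <= e.
Proof.
move=> S0 T0 ST TS; rewrite /hausdorff_dist ge_max sup_inf_closure_le//=.
rewrite (_ : [set inf _ | t in _] =
  [set inf [set `|t - s| | s in closure S] | t in closure T]); last first.
  by apply: eq_imagel => t _; congr inf; apply: eq_imagel => s _; rewrite distrC.
exact: sup_inf_closure_le.
Qed.

Let sup_inf_has_ub (B : R) S T : T !=set0 ->
  (forall s t, S s -> T t -> `|s - t| <= B) ->
  has_ubound [set inf [set `|s - t| | t in T] | s in S].
Proof.
move=> [t Tt] STB; exists B => _ [s Ss <-].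
by apply: (le_trans _ (STB s t Ss Tt)); apply: (ge_inf (dist_set_lb _ _)); exists t.
Qed.

Lemma hausdorff_dist_ge0 S T : 0 <= hausdorff_dist S T.
Proof.
rewrite /hausdorff_dist le_max; apply/orP; left; set E := [set _ | _ in S].
have [[[y Ey] ubE]|/sup_out->//] := pselect (has_sup E).
apply: le_trans (ub_le_sup ubE Ey); case: Ey => s _ <-; have [->|T0] := eqVneq T set0.
  by rewrite image_set0 inf0.
move/set0P : T0 => [t Tt]; apply: lb_le_inf; first by exists `|s - t|, t.
by move=> _ [t' _ <-].
Qed.

(** The bound B makes the suprema in the definition genuine; it passes to the
closures. *)
Lemma hausdorff_dist_lt (B e : R) S T :
  (forall s t, S s -> T t -> `|s - t| <= B) -> T !=set0 ->
  hausdorff_dist (closure S) (closure T) < e ->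
  forall s, S s -> exists2 t, T t & `|s - t| < e.
Proof.
move=> STB [t0 Tt0]; rewrite /hausdorff_dist gt_max => /andP[supe _] s Ss.
have cB s' t' : closure S s' -> closure T t' -> `|s' - t'| <= B.
  move=> cs ct; apply/ler_addgt0Pr => r r0.
  have r20 : 0 < r / 2 by rewrite divr_gt0.
  have [s1 [Ss1 s1s]] := cs _ (nbhsx_ballx s' _ r20).
  have [t1 [Tt1 t1t]] := ct _ (nbhsx_ballx t' _ r20).
  rewrite -ball_normE /= in s1s t1t.
  have := STB s1 t1 Ss1 Tt1.
  have := ler_distD s1 s' t'; have := ler_distD t1 s1 t'.
  by rewrite (distrC t1 t'); lra.
have ub := sup_inf_has_ub (ex_intro _ t0 (subset_closure Tt0)) cB.
have infe : inf [set `|s - t| | t in closure T] < e.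
  apply: le_lt_trans supe; apply: ub_le_sup => //.
  by exists s => //; exact: subset_closure.
have [|_ [t cTt <-] ste] := inf_lt _ infe.
  by exists `|s - t0|, t0 => //; exact: subset_closure.
have d0 : 0 < e - `|s - t| by rewrite subr_gt0.
have [t1 [Tt1 t1t]] := cTt _ (nbhsx_ballx t _ d0).
exists t1 => //; move: t1t; rewrite -ball_normE /= => t1t.
by rewrite (le_lt_trans (ler_distD t _ _))//; lra.
Qed.

End hausdorff_distance.

(** * Correlations and the distance d *)

Section correlations.
Context (Gamma : groupType) (gam : nat -> Gamma) (R : realType).
Context d (X : measurableType d) (mu : probability X R).
Implicit Type a b : mp_action Gamma mu.

Section one_alphabet.
Context (W : finType).
Implicit Type c : X -> W.

Definition correlation a c g v w : R :=
  fine (mu [set x | c (a g^-1%g x) = v /\ c x = w]).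

Lemma measurable_correlation a c g v w : fibers_measurable c ->
  measurable [set x | c (a g^-1%g x) = v /\ c x = w].
Proof.
move=> mc; apply: (measurableI (a g^-1%g @^-1` (c @^-1` [set v])) (c @^-1` [set w])) => //.
by have := measurable_act a g^-1%g measurableT (mc v); rewrite setTI.
Qed.

Lemma correlation01 a c g v w : fibers_measurable c -> 0 <= correlation a c g v w <= 1.
Proof.
move=> mc; have mS := measurable_correlation a g v w mc.
rewrite fine_ge0//= -lee_fin fineK ?fin_num_measure//.
exact: probability_le1.
Qed.

Definition correlations_near n (e : R) a b : Prop :=
  forall c, fibers_measurable c -> exists2 c', fibers_measurable c' &
    forall (p : 'I_n) v w,
      `|correlation a c (gam p) v w - correlation b c' (gam p) v w| <= e.

End one_alphabet.

Lemma correlation_bij (W W' : finType) (h : W -> W') (h' : W' -> W) a (c : X -> W) g v w :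
  cancel h h' -> correlation a (h \o c) g (h v) (h w) = correlation a c g v w.
Proof.
move=> hK; congr (fine (mu _)); apply/seteqP; split => x /= [].
  by move=> /(can_inj hK) ? /(can_inj hK) ?.
by move=> -> ->.
Qed.

Definition label_tensor n k a (c : X -> 'I_k) : 'M[R]_(n, k * k) :=
  partition_tensor gam n a (fun q => c @^-1` [set q]).

Lemma label_tensorE n k a (c : X -> 'I_k) (p : 'I_n) q r :
  label_tensor n a c p (mxvec_index q r) = correlation a c (gam p) q r.
Proof.
rewrite /label_tensor /partition_tensor mxE mxvecE mxE; congr (fine (mu _)).
by rewrite act_imageE.
Qed.

(** Replacing an indexed partition by its label map allows arbitrary finite index
types, such as words. *)
Lemma partition_tensors n k a :
  [set partition_tensor gam n a A | A in @measurable_partition d X k] =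
  [set label_tensor n a c | c in @fibers_measurable d X 'I_k].
Proof.
apply/seteqP; split => [_ [A [mA tA UA] <-]|_ [c mc <-]]; last first.
  exists (fun q => c @^-1` [set q]) => //; split => //.
    by move=> i j _ _ [x [/= <- <-]].
  by apply/seteqP; split => // x _; exists (c x).
have /choice[c cA] x : exists q, A q x.
  by have : [set: X] x by []; rewrite -UA => -[q _ Aqx]; exists q.
have AE : A = fun q => c @^-1` [set q].
  apply/funext => q; apply/seteqP; split => [x Aqx|x /= <-//].
  by apply: (tA _ _ I I); exists x.
by exists c; [move=> q; have := mA q; rewrite AE|rewrite AE].
Qed.

Lemma mx_norm_le n k (M : 'M[R]_(n, k)) e : 0 <= e ->
  (`|M| <= e) <-> (forall i j, `|M i j| <= e).
Proof.
move=> e0; rewrite {1}/Num.norm/= mx_normrE; split=> [/bigmax_leP[_ H] i j|H].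
  exact: (H (i, j)).
by apply/bigmax_leP; split => // -[i j] _; exact: H.
Qed.

Lemma label_tensor_dist n k a b (c c' : X -> 'I_k) e : 0 <= e ->
  (`|label_tensor n a c - label_tensor n b c'| <= e) <->
  (forall (p : 'I_n) q r, `|correlation a c (gam p) q r - correlation b c' (gam p) q r| <= e).
Proof.
move=> e0; rewrite mx_norm_le//.
have E p j : (label_tensor n a c - label_tensor n b c') p j =
    label_tensor n a c p j - label_tensor n b c' p j by rewrite mxE [X in _ + X]mxE.
split => [H p q r|H p j]; first by rewrite -!label_tensorE -E.
by rewrite E; case/mxvec_indexP: j => q r; rewrite !label_tensorE.
Qed.

Definition tensor_dist n k a b : R :=
  hausdorff_dist (@tensor_closure Gamma gam R d X mu n k a) (tensor_closure gam b).

Lemma tensor_distC n k a b : tensor_dist n k a b = tensor_dist n k b a.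
Proof. exact: hausdorff_distC. Qed.

Lemma tensor_dist_ge0 n k a b : 0 <= tensor_dist n k a b.
Proof. exact: hausdorff_dist_ge0. Qed.

Let labels_neq0 k : (0 < k)%N -> exists c : X -> 'I_k, fibers_measurable c.
Proof.
by case: k => // k _; exists (fun=> ord0) => w; rewrite preimage_cst; case: ifP.
Qed.

Lemma tensor_dist_le n k e a b : (0 < k)%N -> 0 <= e ->
  correlations_near 'I_k n e a b -> correlations_near 'I_k n e b a ->
  tensor_dist n k a b <= e.
Proof.
move=> /labels_neq0[c0 mc0] e0 ab ba.
rewrite /tensor_dist /tensor_closure !partition_tensors.
apply: hausdorff_dist_closure_le.
- by exists (label_tensor n a c0), c0.
- by exists (label_tensor n b c0), c0.
- move=> _ [c mc <-]; have [c' mc' cc'] := ab c mc.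
  by exists (label_tensor n b c'); [by exists c'|by apply/label_tensor_dist].
- move=> _ [c mc <-]; have [c' mc' cc'] := ba c mc.
  by exists (label_tensor n a c'); [by exists c'|by apply/label_tensor_dist].
Qed.

Lemma correlation_dist_le1 (W : finType) a b (c c' : X -> W) g v w :
  fibers_measurable c -> fibers_measurable c' ->
  `|correlation a c g v w - correlation b c' g v w| <= 1.
Proof.
move=> mc mc'; rewrite ler_norml.
have := correlation01 a g v w mc; have := correlation01 b g v w mc'.
set x := correlation _ _ _ _ _; set y := correlation _ _ _ _ _.
by move=> /andP[? ?] /andP[? ?]; apply/andP; split; lra.
Qed.

Lemma tensor_dist_le1 n k a b : (0 < k)%N -> tensor_dist n k a b <= 1.
Proof.
by move=> k0; apply: tensor_dist_le => // c mc; exists c => // p v w;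
  exact: correlation_dist_le1.
Qed.

(** Any finite alphabet W may be used, by numbering its letters. *)
Lemma tensor_dist_lt (W : finType) n e a b :
  tensor_dist n #|W| a b < e -> correlations_near W n e a b.
Proof.
move=> he c mc; have e0 : 0 <= e by exact: le_trans (tensor_dist_ge0 _ _ _ _) (ltW he).
have [x0 _] : [set: X] !=set0 by apply/set0P/eqP => X0;
  have := probability_setT mu; rewrite X0 measure0 => /eqP; rewrite eqe eq_sym oner_eq0.
have k0 : (0 < #|W|)%N by apply/card_gt0P; exists (c x0).
have [c0 mc0] := labels_neq0 k0.
have mr : fibers_measurable (enum_rank \o c).
  by move=> q; have := measurable_fibers (fun w => enum_rank w == q) mc;
    congr measurable; apply/seteqP; split => x /= /eqP.
move: he; rewrite /tensor_dist /tensor_closure !partition_tensors.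
move=> /(@hausdorff_dist_lt _ _ 1) H.
have [|||_ [c' mc' <-] /ltW/label_tensor_dist cc'] := H _ _ (label_tensor n a (enum_rank \o c)).
- move=> _ _ [c1 mc1 <-] [c2 mc2 <-]; apply/label_tensor_dist => // p q r.
  exact: correlation_dist_le1.
- by exists (label_tensor n b c0), c0.
- by exists (enum_rank \o c).
exists (enum_val \o c').
  by move=> w; have := measurable_fibers (fun q => enum_val q == w) mc';
    congr measurable; apply/seteqP; split => x /= /eqP.
move=> p v w; have := cc' e0 p (enum_rank v) (enum_rank w).
rewrite (correlation_bij _ _ _ _ _ enum_rankK).
by rewrite -(correlation_bij b c' (gam p) (enum_rank v) (enum_rank w) enum_valK) !enum_rankK.
Qed.

Lemma action_dist_le (M : nat) e a b :
  (forall n k, (1 <= n)%N -> (1 <= k)%N -> (n + k <= M)%N -> tensor_dist n k a b <= e) ->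
  (2 / 3) ^+ M <= e -> action_dist gam a b <= 16 * e.
Proof.
move=> He Me; have e0 : 0 <= e by apply: le_trans Me; rewrite exprn_ge0.
have H := @weighted_series_le R (fun n k => tensor_dist n k a b)
  (fun n k => tensor_dist_ge0 n k a b) M e _ He Me.
rewrite /action_dist -lee_fin.
have {}H : (\sum_(1 <= n <oo) \sum_(1 <= k <oo)
    (2 ^- (n + k) * tensor_dist n k a b)%:E <= (16 * e)%:E)%E.
  by apply: H => n k _ k1; exact: tensor_dist_le1.
rewrite fineK// ge0_fin_numE; first exact: le_lt_trans H (ltry _).
apply: nneseries_ge0 => n _ _; apply: nneseries_ge0 => k _ _.
by rewrite lee_fin mulr_ge0// ?invr_ge0 ?exprn_ge0// tensor_dist_ge0.
Qed.

(** The sum has to be bounded first, since [fine] sends an infinite sum to 0. *)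
Lemma action_dist_lt n k e a b : (1 <= n)%N -> (1 <= k)%N ->
  action_dist gam a b < 2 ^- (n + k) * e -> tensor_dist n k a b < e.
Proof.
move=> n1 k1 H.
have u0 n' k' := tensor_dist_ge0 n' k' a b.
have T := weighted_series_term u0 n1 k1.
have B := @weighted_series_le R _ u0 0 1 (fun n k _ k1 => tensor_dist_le1 n a b k1)
  (fun n k _ k1 _ => tensor_dist_le1 n a b k1).
have {}B := B ltac:(by rewrite expr0).
have p0 : 0 < 2 ^- (n + k) :> R by rewrite invr_gt0 exprn_gt0.
rewrite -(ltr_pM2l p0); apply: le_lt_trans H.
rewrite -lee_fin /action_dist fineK//.
rewrite ge0_fin_numE; first exact: le_lt_trans B (ltry _).
by apply: le_trans T; rewrite lee_fin mulr_ge0// ltW.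
Qed.

End correlations.

(** * Correlations versus orbit codes *)

Section orbit_codes_and_correlations.
Context (Gamma : groupType) (gam : nat -> Gamma) (R : realType).
Context (gam_surj : forall g, exists i, gam i = g).
Context d (X : measurableType d) (mu : probability X R).
Implicit Type a b : mp_action Gamma mu.

Lemma orbit_code_bit N (phi : X -> cantor_space) a x (p : 'I_N * 'I_N) :
  orbit_code gam N phi a x p = (phi (a (gam p.1)^-1%g x) : nat -> bool) p.2.
Proof. by rewrite ffunE. Qed.

Lemma orbit_code_bit1 N (phi : X -> cantor_space) a x (i j : 'I_N) : gam i = 1%g ->
  orbit_code gam N phi a x (i, j) = (phi x : nat -> bool) j.
Proof. by move=> gi; rewrite orbit_code_bit /= gi invg1 act1. Qed.

(** The compatibility rule: the row at the identity of the code of gam_i^-1 x is the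
row at gam_i of the code of x. *)
Lemma orbit_code_bit_act N (phi : X -> cantor_space) a x (i0 i j : 'I_N) : gam i0 = 1%g ->
  orbit_code gam N phi a (a (gam i)^-1%g x) (i0, j) = orbit_code gam N phi a x (i, j).
Proof. by move=> gi0; rewrite orbit_code_bit1// orbit_code_bit. Qed.

Lemma measurable_label_fin (W : finType) (c : X -> W) (h : W -> cantor_space) :
  fibers_measurable c -> measurable_label (h \o c).
Proof.
move=> mc _ B mB; rewrite setTI.
have := measurable_fibers (fun w => `[< B (h w) >]) mc; congr measurable.
by apply/seteqP; split => x /= => [/asboolP//|Bx]; exact/asboolP.
Qed.

Definition unary k (q : 'I_k) : cantor_space := fun j => j == q :> nat.

Definition unary_decode k (f : nat -> bool) : 'I_k.+1 :=
  if [pick q : 'I_k.+1 | f q] is Some q then q else ord0.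

Lemma unaryK k : cancel (@unary k.+1) (@unary_decode k).
Proof.
move=> q; rewrite /unary_decode /unary; case: pickP => [q' /eqP/val_inj//|/(_ q)].
by rewrite eqxx.
Qed.

(** Decoding is done on words, so that the labels of the translates of x are a
function of the code of x. *)
Definition decode_row N k (kN : (k < N)%N) (w : word N) (i : 'I_N) : 'I_k.+1 :=
  if [pick q : 'I_k.+1 | w (i, widen_ord kN q)] is Some q then q else ord0.

Lemma decode_row_orbit N k (kN : (k < N)%N) phi a x i :
  decode_row kN (orbit_code gam N phi a x) i = unary_decode k (phi (a (gam i)^-1%g x)).
Proof.
rewrite /decode_row /unary_decode.
by under eq_pick => q do rewrite orbit_code_bit /=.
Qed.

(** Write the labels c in unary to get a map phi into K, and replace the law of its
orbit by that of some phi' for b.  The decoded labels of gam_p^-1 x and of x are a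
function of the code of x, so a correlation is the probability of a set of words,
which varies by at most [code_dist]. *)
Lemma correlations_near_of_codes N n k (i0 : 'I_N) (e : R) a b :
  gam i0 = 1%g -> (n <= N)%N -> (0 < k <= N)%N ->
  (forall nu, orbit_measures a nu ->
    exists2 nu', orbit_measures b nu' & code_dist gam N nu nu' < e) ->
  correlations_near gam 'I_k n e a b.
Proof.
case: k => // k gi0 nN kN Hab c mc.
have mphi := measurable_label_fin (@unary k.+1) mc.
set phi := _ \o _ in mphi.
have [nu nuE] := orbit_measure_ex gam_surj a mphi.
have [nu' [phi' mphi' nu'E] dist] : exists2 nu', orbit_measures b nu' & code_dist gam N nu nu' < e.
  by apply: Hab; exists phi.
have ma := orbit_code_measurable gam (N := N) a mphi.
have mb := orbit_code_measurable gam (N := N) b mphi'.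
pose dec (psi : X -> cantor_space) x := unary_decode k (psi x).
have decE (psi : X -> cantor_space) (c' : mp_action Gamma mu) (p : 'I_n) v w :
    fibers_measurable (orbit_code gam N psi c') ->
    correlation c' (dec psi) (gam p) v w = \sum_(u | (decode_row kN u (widen_ord nN p) == v) &&
      (decode_row kN u i0 == w)) law mu (orbit_code gam N psi c') u.
  move=> mpsi; rewrite -law_sum//; congr (fine (mu _)); apply/seteqP.
  split => x /=; rewrite !decode_row_orbit gi0 invg1 act1 /dec /=.
    by move=> [-> ->]; rewrite !eqxx.
  by move=> /andP[/eqP -> /eqP ->].
exists (dec phi').
  move=> w; have := measurable_fibers (fun u => decode_row kN u i0 == w) mb.
  congr measurable; apply/seteqP.
  by split => x /=; rewrite decode_row_orbit gi0 invg1 act1 => /eqP.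
move=> p v w; have -> : c = dec phi by apply/funext => x; rewrite /dec /phi /= unaryK.
rewrite !decE//; apply: le_trans (ltW dist).
rewrite /code_dist (orbit_code_law gam N nuE) (orbit_code_law gam N nu'E).
exact: l1_dist_sum.
Qed.

Lemma measure_union_le (I : finType) (S : set X) (B : I -> set X) : measurable S ->
  (forall i, measurable (B i)) -> (forall x, S x -> exists i, B i x) ->
  fine (mu S) <= \sum_i fine (mu (B i)).
Proof.
move=> mS mB SB; have [mU le] : measurable (\big[setU/set0]_i B i) /\
    fine (mu (\big[setU/set0]_i B i)) <= \sum_i fine (mu (B i)).
  elim/big_rec2: _ => [|i s U _ [mU Us]]; first by rewrite measure0.
  have mBU : measurable (B i `|` U) by exact: measurableU.
  split => //; apply: le_trans (lerD (lexx _) Us).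
  rewrite -fineD ?fin_num_measure// fine_le ?fin_numD ?fin_num_measure//.
  exact: measureU2.
apply: le_trans le; rewrite fine_le ?fin_num_measure// le_measure ?inE//.
move=> x /SB[i Bix]; rewrite -bigcup_seq; exists i => //=.
by rewrite mem_index_enum.
Qed.

Definition pad_row N (i : 'I_N) (w : word N) : cantor_space :=
  fun j => if insub j is Some j' then w (i, j') else false.

Lemma pad_rowE N (i j : 'I_N) (w : word N) : (pad_row i w : nat -> bool) j = w (i, j).
Proof. by rewrite /pad_row valK. Qed.

(** A crude bound: one union bound over the pairs of words at each gam_i, and one
error for each of the words. *)
Definition code_error N : R :=
  #|{: word N}|%:R * (#|{: 'I_N * (word N * word N)}|%:R + 1).

(** Take the code of phi as the label for a, let c be an approximating label for b,
and let psi be read from the identity row of c.  Pairs of words violating the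
compatibility rule have correlation 0 for a, hence at most e for b; outside the
corresponding small set the word c x is the code of x under psi. *)
Lemma codes_of_correlations_near N (i0 : 'I_N) (e : R) a b : 0 <= e ->
  gam i0 = 1%g -> correlations_near gam (word N) N e a b ->
  forall nu, orbit_measures a nu ->
    exists2 nu', orbit_measures b nu' & code_dist gam N nu nu' <= code_error N * e.
Proof.
move=> e0 gi0 Hab nu [phi mphi nuE].
have ma := orbit_code_measurable gam (N := N) a mphi.
have [c mc cE] := Hab _ ma.
pose psi := pad_row i0 \o c.
have mpsi : measurable_label psi by exact: measurable_label_fin.
have mb := orbit_code_measurable gam (N := N) b mpsi.
have [nu' nu'E] := orbit_measure_ex gam_surj b mpsi.
exists nu'; first by exists psi.
rewrite /code_dist (orbit_code_law gam N nuE) (orbit_code_law gam N nu'E).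
pose bad (t : 'I_N * (word N * word N)) := [exists j, t.2.1 (i0, j) != t.2.2 (t.1, j)].
pose B t := if bad t then [set x | c (b (gam t.1)^-1%g x) = t.2.1 /\ c x = t.2.2] else set0.
have mB t : measurable (B t).
  by rewrite /B; case: ifP => // _; exact: measurable_correlation.
have Be t : fine (mu (B t)) <= e.
  rewrite /B; case: ifPn => [/existsP[j vw]|_]; last by rewrite measure0.
  have := cE t.1 t.2.1 t.2.2.
  rewrite [X in X - _](_ : _ = 0) ?sub0r ?normrN.
    by move=> /(le_trans (ler_norm _)).
  rewrite /correlation [X in mu X](_ : _ = set0) ?measure0//.
  apply/seteqP; split => // x /= [v w]; case/eqP: vw.
  by rewrite -v -w orbit_code_bit_act.
(* A place (i, j) where c x and the code of x under psi disagree exhibits a bad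
   pair for gam i. *)
have err : fine (mu [set x | c x != orbit_code gam N psi b x]) <=
    #|{: 'I_N * (word N * word N)}|%:R * e.
  apply: (@le_trans _ _ (\sum_t fine (mu (B t)))); last first.
    by rewrite mulr_natl -sumr_const; apply: ler_sum.
  apply: measure_union_le => //; first exact: measurable_fibers_ne.
  move=> x /= neq.
  have [[i j]] : exists p, c x p != orbit_code gam N psi b x p.
    by apply/existsP; apply: contraNT neq => /existsPn H; apply/eqP/ffunP => p;
      have := H p; rewrite negbK => /eqP.
  rewrite -(orbit_code_bit_act _ _ _ _ _ gi0) orbit_code_bit1// /psi /= pad_rowE => cij.
  exists (i, (c (b (gam i)^-1%g x), c x)); rewrite /B /=.
  by rewrite (_ : bad _)//; apply/existsP; exists j; rewrite eq_sym.
rewrite (le_trans (l1_dist_triangle (law mu c) _ _))// /code_error.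
rewrite -mulrA mulrDl mul1r mulrDr addrC lerD//.
  by rewrite l1_distC; apply: l1_dist_le => w; rewrite distrC; exact: law_ne_le.
apply: l1_dist_le => w.
have lawE (a' : mp_action Gamma mu) c' : law mu c' w = correlation a' c' (gam i0) w w.
  rewrite /law /correlation gi0; congr (fine (mu _)); apply/seteqP.
  split => x /=; rewrite invg1 act1; first by move=> ->.
  by case.
by rewrite (lawE a (orbit_code gam N phi a)) (lawE b c); exact: cE.
Qed.

End orbit_codes_and_correlations.

(** * Neighbourhoods for d, and the two topologies *)

Lemma archimed_inv (R : realType) (e : R) : 0 < e ->
  exists N, forall M, (N <= M)%N -> M.+1%:R^-1 < e.
Proof.
move=> e0; exists (Num.bound e^-1) => M NM.
have eV0 : 0 <= e^-1 by rewrite invr_ge0 ltW.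
have MN1 : (Num.bound e^-1)%:R <= M.+1%:R :> R by rewrite ler_nat (leq_trans NM).
by rewrite invf_plt ?posrE//; exact: lt_le_trans (archi_boundP eV0) MN1.
Qed.

(** Both directions quantify over windows containing the identity, which is where
the label of a point is read. *)
Lemma tau1P (R : realType) (Gamma : groupType) (gam : nat -> Gamma)
    (gam_surj : forall g, exists i, gam i = g)
    (d : measure_display) (X : measurableType d) (mu : probability X R)
    (V : set (weq_class Gamma mu)) : tau1 gam mu V <->
  forall x, V x -> exists N, forall y, orbit_near gam N (repr x) (repr y) -> V y.
Proof.
have [i0 gi0] := gam_surj 1%g.
split=> [HV x /HV[eps eps0 sub]|HV x /HV[N0 HN]].
  have e0 : 0 < eps / 32 by rewrite divr_gt0.
  have [M Me] : exists M, (2 / 3) ^+ M <= eps / 32.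
    have /cvgrPdist_lt/(_ _ e0)[M _ HM] : (2 / 3 : R) ^+ n @[n --> \oo] --> (0 : R).
      by apply: cvg_expr; rewrite ger0_norm; lra.
    by exists M; have := HM M (leqnn M); rewrite sub0r normrN => /(le_lt_trans (ler_norm _))/ltW.
  have [N1 HN1] := archimed_inv e0.
  pose N := maxn M (maxn i0.+1 N1).
  have iN : (i0 < N)%N by rewrite leq_max leq_maxl orbT.
  have MN : (M <= N)%N by rewrite leq_maxl.
  have /HN1/ltW NE : (N1 <= N)%N by rewrite !leq_max leqnn !orbT.
  exists N => y [yx xy]; apply: sub => /=; rewrite /weq_dist.
  apply: (@le_lt_trans _ _ (16 * (eps / 32))); last by lra.
  apply: action_dist_le Me => n k n1 k1 nkM; apply: le_trans NE.
  have nN : (n <= N)%N by apply: leq_trans MN; apply: leq_trans nkM; exact: leq_addr.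
  have kN : (0 < k <= N)%N.
    by rewrite k1 (leq_trans _ MN)// (leq_trans _ nkM)// leq_addl.
  apply: tensor_dist_le => //.
    exact: (correlations_near_of_codes gam_surj (i0 := Ordinal iN)).
  apply: (correlations_near_of_codes gam_surj (i0 := Ordinal iN)) => // nu /yx[nu' ? ?].
  by exists nu'; rewrite // code_distC.
pose N := maxn N0 i0.+1; have iN : (i0 < N)%N by rewrite leq_maxr.
have C0 : 0 <= code_error R N by rewrite mulr_ge0// addr_ge0.
have C1 : 0 < code_error R N + 1 by rewrite ltr_wpDl.
pose e := N.+1%:R^-1 / (code_error R N + 1).
have e0 : 0 < e by rewrite divr_gt0// invr_gt0.
have Ce : code_error R N * e < N.+1%:R^-1.
  by rewrite mulrA ltr_pdivrMr// mulrC ltr_pM2l ?invr_gt0// ltrDl.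
exists (2 ^- (N + #|{: word N}|) * e); first by rewrite mulr_gt0// invr_gt0 exprn_gt0.
move=> y /= xy; apply: HN; apply: (orbit_near_mono (leq_maxl N0 i0.+1)).
have tlt : tensor_dist gam N #|{: word N}| (repr x) (repr y) < e.
  apply: action_dist_lt xy; first exact: leq_trans iN.
  by apply/card_gt0P; exists [ffun=> false].
split=> [nu Enu|nu Enu].
  move: tlt; rewrite tensor_distC => /tensor_dist_lt cn.
  have [nu' Enu' le] := codes_of_correlations_near gam_surj
    (i0 := Ordinal iN) (ltW e0) gi0 cn Enu.
  by exists nu'; rewrite // code_distC (le_lt_trans le).
have [nu' Enu' le] := codes_of_correlations_near gam_surj
  (i0 := Ordinal iN) (ltW e0) gi0 (tensor_dist_lt tlt) Enu.
by exists nu'; rewrite // (le_lt_trans le).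
Qed.

Theorem theorem3p1 (R : realType)
    (Gamma : groupType) (Gamma_countable : countable [set: Gamma])
    (gam : nat -> Gamma) (gam_enum : enumerates gam)
    (d : measure_display) (X : measurableType d) (mu : probability X R)
    (X_standard : standard_borel R X) (mu_nonatomic : nonatomic mu) :
  tau1 gam mu = tau2 Gamma mu.
Proof.
have [gam_surj _] := gam_enum.
apply/seteqP; split => V.
  by move=> /(tau1P gam_surj)/(tau2P gam_surj).
by move=> /(tau2P gam_surj)/(tau1P gam_surj).
Qed.
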